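(* Fix an arbitrary environment $(\mathcal A,\mathcal O,\rho)$, a finite aleatoric state set $\mathcal S$, an initial aleatoric state $S_0\in\mathcal S$, an aleatoric state update function $f:\mathcal S\times\mathcal A\times\mathcal O\to\mathcal S$ and a reward function $r:\mathcal S\times\mathcal A\times\mathcal O\to[0,1]$. Let $\pi_{\rm agent}$ be the policy executed by the growing-horizon Q-learning algorithm (defined in the context) and, for a policy $\pi$, let $\mathrm{Regret}_\pi(T)=\mathbb E_{\pi_{\rm agent}}\big[\sum_{t=0}^{T-1}(\lambda_\pi-R_{t+1})\big]$. Then for all policies $\pi\in\mathcal P$ and all integers $T\ge 1$, $$\mathrm{Regret}_{\pi}(T)\le\Big(120\sqrt{|\mathcal S||\mathcal A|\log(2T^2)}+5\tau_\pi\Big)T^{4/5}+3\,\overline{\Delta}_{\tau_\pi}T+\big(54|\mathcal S||\mathcal A|+18\log T\big)T^{1/5}+2\tau_\pi^5 .$$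
   Context: Environment, histories, policies. $\mathcal A,\mathcal O$ are nonempty finite sets. A history is a finite sequence $h=(a_0,o_1,\dots,a_{t-1},o_t)$ with $a_i\in\mathcal A$, $o_i\in\mathcal O$; $\mathcal H$ is the set of all histories, $H_0=()$ is the empty one, and $(h,a,o)$ denotes concatenation. The environment is given by a function $\rho$ with $\rho(\cdot|h,a)$ a probability distribution on $\mathcal O$ for each $(h,a)\in\mathcal H\times\mathcal A$ (held fixed; all expectations are conditional on the environment). A policy $\pi$ assigns to each $h\in\mathcal H$ a probability distribution $\pi(\cdot|h)$ on $\mathcal A$; $\mathcal P$ is the set of all policies. Under $\pi$, at each time $t=0,1,2,\dots$: $A_t\sim\pi(\cdot|H_t)$, $O_{t+1}\sim\rho(\cdot|H_t,A_t)$, $H_{t+1}=(H_t,A_t,O_{t+1})$; $\mathbb E_\pi$ is the corresponding expectation. Aleatoric states and rewards. $\phi:\mathcal H\to\mathcal S$ is defined by $\phi(H_0)=S_0$ and $\phi((h,a,o))=f(\phi(h),a,o)$. $S_t=\phi(H_t)$ and $R_{t+1}=r(S_t,A_t,O_{t+1})$. Average reward and averaging time. $\lambda_\pi=\liminf_{T\to\infty}\mathbb E_\pi[\frac1T\sum_{t=0}^{T-1}R_{t+1}]$, starting from the empty history. $\lambda_\pi(h,T)$ is the expected average reward over $T$ timesteps when interaction starts at history $h$ (instead of $H_0$) and actions are selected by $\pi$. The reward averaging time $\tau_\pi$ is the smallest $\tau\in[0,\infty)$ with $|\lambda_\pi(h,T)-\lambda_\pi|\le\tau/T$ for all $h\in\mathcal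 H$ and $T\ge1$ ($\tau_\pi=\infty$ if there is none, in which case the bound is read as trivial). Optimal discounted values and distortion. For $\gamma\in[0,1)$, $V_\pi^\gamma(h)$ is the expected discounted sum of rewards (the reward realized after $k$ timesteps being weighted by $\gamma^k$) starting at history $h$ and following $\pi$; $Q_\pi^\gamma(h,a)=\bar r_{ah}+\gamma\sum_{o}\rho(o|h,a)V_\pi^\gamma((h,a,o))$ with $\bar r_{ah}=\sum_o\rho(o|h,a)r(\phi(h),a,o)$; $V_*^\gamma=\sup_\pi V_\pi^\gamma$, $Q_*^\gamma=\sup_\pi Q_\pi^\gamma$. For $\tau\ge1$, with $\gamma=1-1/\tau$, $$\Delta_\tau=\max_{(s,a)\in\mathcal S\times\mathcal A}\Big(\sup_{h:\phi(h)=s}Q_*^\gamma(h,a)-\inf_{h:\phi(h)=s}Q_*^\gamma(h,a)\Big)$$ (only $s$ in the range of $\phi$ matter), and $\overline\Delta_\tau=\sup_{\tau'\ge\tau,\ \tau'\ge 1}\Delta_{\tau'}$. Growing-horizon Q-learning. Change points: $T_0=1$, $T_k=20\cdot2^{k-1}$ for $k\ge1$. For $t\ge1$ let $k_t=\max\{k\ge0:T_k\le t\}$, and $k_0=0$. Initialize $s\leftarrow S_0$, $Q(\cdot,\cdot)\leftarrow1$, $N(\cdot,\cdot)\leftarrow0$ (tables on $\mathcal S\times\mathcal A$). For $t=1,2,\dots$: (1) $\tau\leftarrow T_{k_t}^{1/5}$, $\beta\leftarrow4T_{k_t}^{3/10}\sqrt{\log(2T_{k_t}^2)}$; (2) add $T_{k_t}^{1/5}-T_{k_{t-1}}^{1/5}$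 to all entries of $Q$; multiply all entries of $N$ by $\mathbf 1(T_{k_t}=T_{k_{t-1}})$; (3) sample $a$ uniformly from $\arg\max_{a'}Q(s,a')$, execute $a$ (this is action $A_{t-1}$) and register the observation $o$ (this is $O_t$); (4) $N(s,a)\leftarrow N(s,a)+1$, $\alpha\leftarrow\frac{1+2\tau}{N(s,a)+2\tau}$, $s'\leftarrow f(s,a,o)$, $\gamma\leftarrow1-1/\tau$; (5) $Q(s,a)\leftarrow Q(s,a)+\alpha\big(r(s,a,o)+\gamma\max_{a'}Q(s',a')-Q(s,a)+\beta/\sqrt{N(s,a)}\big)$, then $Q(s,a)\leftarrow\min(Q(s,a),\tau)$, then $s\leftarrow s'$. *)

(* Defs.v *)
From HB Require Import structures.
From mathcomp Require Import all_boot all_order all_algebra.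
From mathcomp Require Import all_classical all_reals all_analysis.

Set Implicit Arguments.
Unset Strict Implicit.
Unset Printing Implicit Defensive.

Import Order.TTheory GRing.Theory Num.Theory.
Import numFieldNormedType.Exports.

Local Open Scope classical_set_scope.
Local Open Scope ring_scope.

Record fdist (R : realType) (X : finType) := FDist {
  pmf :> X -> R;
  pmf_ge0 : forall x, 0 <= pmf x;
  pmf_sum1 : \sum_(x : X) pmf x = 1
}.

Section Uniform.
Context (R : realType) (X : finType) (B : {set X}) (B_gt0 : (0 < #|B|)%N).

Definition unif_pmf (x : X) : R := if x \in B then #|B|%:R^-1 else 0.

Lemma unif_pmf_ge0 x : 0 <= unif_pmf x.
Proof. by rewrite /unif_pmf; case: ifP => // _; rewrite invr_ge0. Qed.

Lemma unif_pmf_sum1 : \sum_(x : X) unif_pmf x = 1.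
Proof.
rewrite /unif_pmf -big_mkcond /= sumr_const -[X in X = _]mulr_natl divff //.
by rewrite pnatr_eq0 -lt0n.
Qed.

Definition unif : fdist R X := FDist unif_pmf_ge0 unif_pmf_sum1.

End Uniform.

Section Interaction.
Context (R : realType) (A O S : finType).

(* The sequence [:: (a_0, o_1); ...; (a_(t-1), o_t)]; the triple (h, a, o) of
   the mathematics is rcons h (a, o). *)
Definition history := seq (A * O).

Definition environment := history -> A -> fdist R O.

Definition policy := history -> fdist R A.

Context (rho : environment) (S0 : S) (f : S -> A -> O -> S) (r : S -> A -> O -> R).

Definition phi (h : history) : S := foldl (fun s ao => f s ao.1 ao.2) S0 h.

(* Probability that the interaction, started at history h under pi, continues
   with the action/observation pairs listed in w. *)
Fixpoint path_prob (pi : policy) (h : history) (w : seq (A * O)) : R :=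
  if w is (a, o) :: w' then
    pi h a * rho h a o * path_prob pi (rcons h (a, o)) w'
  else 1.

(* Expectation, under pi started at h, of a function F of the n next
   action/observation pairs. *)
Definition expect (pi : policy) (h : history) (n : nat)
    (F : n.-tuple (A * O) -> R) : R :=
  \sum_(w : n.-tuple (A * O)) path_prob pi h w * F w.

(* The (t+1)-st reward after h along the continuation w: it is computed from
   the aleatoric state of the history h ++ take t w. *)
Definition reward (h : history) (n : nat) (w : n.-tuple (A * O)) (t : 'I_n) : R :=
  r (phi (h ++ take t w)) (tnth w t).1 (tnth w t).2.

Definition avg_reward_from (pi : policy) (h : history) (T : nat) : R :=
  expect pi h (fun w : T.-tuple (A * O) => T%:R^-1 * \sum_(t < T) reward h w t).

(* The sequence is bounded when r is, so its real inferior limit is genuine;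
   the value at T = 0 is irrelevant. *)
Definition avg_reward (pi : policy) : R :=
  limn_inf (fun T => avg_reward_from pi [::] T).

(* +oo when the set is empty; otherwise the infimum is attained. *)
Definition averaging_time (pi : policy) : \bar R :=
  ereal_inf [set tau%:E | tau in [set tau : R | 0 <= tau /\
    forall (h : history) (T : nat), (1 <= T)%N ->
      `|avg_reward_from pi h T - avg_reward pi| <= tau / T%:R]].

(* Limit of the expected n-step discounted rewards; for 0 <= gamma < 1 and
   bounded r the limit exists and equals the expectation of the infinite
   discounted sum. *)
Definition V (gamma : R) (pi : policy) (h : history) : R :=
  limn (fun n => expect pi h
    (fun w : n.-tuple (A * O) => \sum_(k < n) gamma ^+ k * reward h w k)).

Definition mean_reward (h : history) (a : A) : R :=
  \sum_(o : O) rho h a o * r (phi h) a o.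

Definition Q (gamma : R) (pi : policy) (h : history) (a : A) : R :=
  mean_reward h a + gamma * \sum_(o : O) rho h a o * V gamma pi (rcons h (a, o)).

(* For r with values in [0, 1], the values Q gamma pi h a lie in
   [0, 1 / (1 - gamma)], so this real supremum, and those of distortion, are
   taken over bounded sets. *)
Definition Qstar (gamma : R) (h : history) (a : A) : R :=
  sup [set Q gamma pi h a | pi in [set: policy]].

Definition distortion (tau : R) : R :=
  let gamma := 1 - tau^-1 in
  \big[Num.max/0]_(sa : S * A | `[< exists h, phi h = sa.1 >])
    (sup [set Qstar gamma h sa.2 | h in [set h | phi h = sa.1]] -
     inf [set Qstar gamma h sa.2 | h in [set h | phi h = sa.1]]).

(* Supremum in [0, +oo]; hence 0, and not -oo, when tau = +oo. *)
Definition sup_distortion (tau : \bar R) : \bar R :=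
  maxe 0%E (ereal_sup [set (distortion tau')%:E |
    tau' in [set tau' : R | (tau <= tau'%:E)%E /\ 1 <= tau']]).

Definition regret (agent pi : policy) (T : nat) : R :=
  expect agent [::]
    (fun w : T.-tuple (A * O) => \sum_(t < T) (avg_reward pi - reward [::] w t)).

End Interaction.

Definition change_point (k : nat) : nat :=
  if k is k'.+1 then (20 * 2 ^ k')%N else 1%N.

(* k_t: the largest k with change_point k <= t, and 0 for t = 0. Bounding k
   by t loses nothing since k <= change_point k. *)
Definition epoch (t : nat) : nat :=
  (\max_(k < t.+1 | change_point k <= t) k)%N.

Definition epoch_start (t : nat) : nat := change_point (epoch t).

Section QLearning.
Context (R : realType) (A O S : finType) (a0 : A).
Context (S0 : S) (f : S -> A -> O -> S) (r : S -> A -> O -> R).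

Record agent_state := AgentState {
  cur : S;
  qtab : S -> A -> R;
  ntab : S -> A -> nat
}.

Definition max_action (q : A -> R) : R := \big[Num.max/q a0]_(a : A) q a.

Definition greedy (q : A -> R) : {set A} := [set a | q a == max_action q].

Lemma greedy_gt0 (q : A -> R) : (0 < #|greedy q|)%N.
Proof.
have [a _ qmax] := @arg_maxP _ _ _ a0 xpredT q isT.
apply/card_gt0P; exists a; rewrite inE; apply/eqP/le_anti.
rewrite le_bigmax /=; apply/bigmax_leP; split; first exact: qmax.
by move=> b _; exact: qmax.
Qed.

Definition tau_at (t : nat) : R := (epoch_start t)%:R `^ (1 / 5).

Definition beta_at (t : nat) : R :=
  4 * (epoch_start t)%:R `^ (3 / 10) *
  Num.sqrt (ln (2 * (epoch_start t)%:R ^+ 2)).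

Definition init_state : agent_state :=
  AgentState S0 (fun _ _ => 1) (fun _ _ => 0%N).

(* What iteration t does before selecting its action. *)
Definition before_action (t : nat) (st : agent_state) : agent_state :=
  AgentState (cur st)
    (fun s a => qtab st s a + (tau_at t - tau_at t.-1))
    (fun s a => (ntab st s a * (epoch_start t == epoch_start t.-1))%N).

(* What iteration t does once action a has been executed and o observed. *)
Definition after_action (t : nat) (st : agent_state) (a : A) (o : O) :
    agent_state :=
  let s := cur st in
  let tau := tau_at t in
  let beta := beta_at t in
  let N := (ntab st s a).+1 in
  let alpha := (1 + 2 * tau) / (N%:R + 2 * tau) in
  let s' := f s a o in
  let gamma := 1 - tau^-1 in
  let q := qtab st s a +
    alpha * (r s a o + gamma * max_action (qtab st s') - qtab st s a
             + beta / Num.sqrt N%:R) in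
  AgentState s'
    (fun x b => if (x == s) && (b == a) then Num.min q tau else qtab st x b)
    (fun x b => if (x == s) && (b == a) then N else ntab st x b).

(* Agent state after the iterations t, t + 1, ... that produced h. *)
Fixpoint run (t : nat) (st : agent_state) (h : history A O) : agent_state :=
  if h is (a, o) :: h' then
    run t.+1 (after_action t (before_action t st) a o) h'
  else st.

(* After history h the action is selected in iteration size h + 1. *)
Definition agent_policy : policy R A O := fun h =>
  let st := before_action (size h).+1 (run 1 init_state h) in
  unif R (greedy_gt0 (qtab st (cur st))).

End QLearning.

(* Main.v *)
(** In an epoch of horizon [tau] the table of the agent is compared not with
    [Qstar] at horizon [tau] but with a slightly pessimistic reference: [Qstar]
    at the shorter horizon [u = (20/21) tau], shifted by the constant that makes
    it a subsolution of the Bellman equation at horizon [tau].  If the policy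
    [pi], of average reward [lam], has averaging time [tp <= u], this reference
    is at least [lam tau - (21/20) tp], and it stays below the truncation level
    [tau] of the algorithm by a margin proportional to its own span.  The margin
    is needed: against [Qstar] at horizon [tau], a single unlucky transition
    that follows a truncation [min(Q, tau)] may destroy optimism.

    With [ref] the reference and [E = tau Delta + D + 1], optimism means
    [Q >= ref - E].  It fails within an epoch with small probability only: for
    a pair visited [n] times, [exp (K sqrt n (ref - E - Q))] is a supermartingale
    up to negligible additive terms, by Hoeffding's lemma; an update truncated
    at [tau] contributes such a term because of the margin.

    While optimism holds, the regret is bounded along every path.  The step size
    [(1 + 2 tau) / (n + 2 tau)] makes the potential
    [sum (N + 2 tau) / (1 + 2 tau) (Q - c) - gamma (max Q - c)], corrected by
    [sqrt N] terms that pay for the bonuses, decrease by at least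
    [lam - r - (kappa + E) / tau] at each step, where [kappa = (21/20) tp] and
    [c] is a lower bound of [max Q] given by optimism.

    Adding [tau_(k+1) - tau_k] to the table preserves optimism from an epoch to
    the next one; after an epoch [k] that failed, or was too short for the above,
    [Q >= 0] restores it at the price of increasing [D] by [tau_k].  As [D] is
    initially [kappa + 4], the coefficient of [T^(4/5)] receives
    [2 kappa] times [sum_k tau_k^4 <= (50/21) T^(4/5)], that is [5 tp]. *)

Require Import Defs.
From HB Require Import structures.
From mathcomp Require Import all_boot all_order all_algebra.
From mathcomp Require Import all_classical all_reals all_analysis.
From mathcomp Require Import ring lra zify.

Set Implicit Arguments.
Unset Strict Implicit.
Unset Printing Implicit Defensive.

Import Order.TTheory GRing.Theory Num.Theory.
Import numFieldNormedType.Exports.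

Local Open Scope ring_scope.

(** * Hoeffding's lemma *)

Section Hoeffding.
Context (R : realType).
Implicit Types p x y : R.

Let mgf p y : R := 1 - p + p * expR y.

Let mgf_gt0 p y : 0 <= p <= 1 -> 0 < mgf p y.
Proof.
move=> /andP[p0 p1]; have := expR_gt0 y => e0; rewrite /mgf.
have [->|p_neq] := eqVneq p 0; first by rewrite mul0r addr0 subr0.
by rewrite ltr_wpDl ?subr_ge0 // mulr_gt0 // lt_neqAle eq_sym p_neq.
Qed.

Lemma ge0_is_derive_ge0 (f f' : R -> R) :
  (forall x : R, 0 <= x -> is_derive x 1 f (f' x)) ->
  (forall x, 0 <= x -> 0 <= f' x) -> f 0 = 0 -> forall x, 0 <= x -> 0 <= f x.
Proof.
move=> fD f'0 f0 x x0; rewrite -f0.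
apply: (@ger0_derive1_ndecr _ _ 0 x) => //.
- by move=> y; rewrite in_itv /= => /andP[/ltW /fD[]].
- move=> y; rewrite in_itv /= => /andP[/ltW y0 _].
  by rewrite derive1E; have [_ ->] := fD _ y0; exact: f'0.
- apply: derivable_within_continuous => y; rewrite in_itv /= => /andP[/fD[]].
  by [].
Qed.

Let is_derive_mgf p x : is_derive x 1 (mgf p) (p * expR x).
Proof.
have h1 : is_derive x 1 (p \*: (expR : R -> R^o)) (p *: (expR x : R^o)).
  exact: is_deriveZ.
have := is_deriveD (is_derive_cst (1 - p : R^o) x 1) h1.
by rewrite add0r.
Qed.

(** The derivative in [y] of [p * y + y ^+ 2 / 8 - ln (mgf p y)]. The quotient
    [p * expR y / mgf p y] is written [1 - (1 - p) / mgf p y], so that only an inverse has to be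
    differentiated. *)
Let dlog p y : R := p + y / 4 - (1 - (1 - p) * (mgf p y)^-1).

Let dlog_ge0 p y : 0 <= p <= 1 -> 0 <= y -> 0 <= dlog p y.
Proof.
move=> p01.
pose f' x := 4^-1 + (1 - p) * (- (mgf p x) ^- 2 * (p * expR x)).
apply: (@ge0_is_derive_ge0 _ f') => [x _|x _|].
- have m0 := mgf_gt0 x p01.
  have h1 : is_derive x 1 (fun x => (mgf p x)^-1) (- (mgf p x) ^- 2 *: (p * expR x)).
    by apply: is_deriveV; [rewrite gt_eqF | exact: is_derive_mgf].
  have h2 : is_derive x 1 ((1 - p) \*: (fun x => (mgf p x)^-1 : R^o))
     ((1 - p) *: (- (mgf p x) ^- 2 *: (p * expR x) : R^o)).
    exact: is_deriveZ.
  have h3 : is_derive x 1 (4^-1 \*: (id : R -> R^o)) (4^-1 *: (1 : R^o)).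
    exact: is_deriveZ.
  have := is_deriveD (is_deriveD (is_derive_cst (p - 1 : R^o) x 1) h3) h2.
  rewrite add0r => h.
  rewrite (_ : dlog p = (cst (p - 1) + 4^-1 \*: id + (1 - p) \*: (fun x => (mgf p x)^-1))).
    by move: h; rewrite /f' /GRing.scale /= mulr1.
  apply/funext => z; rewrite /dlog !fctE.
  change (p + z / 4 - (1 - (1 - p) / mgf p z) =
    p - 1 + 4^-1 * z + (1 - p) * (mgf p z)^-1).
  ring.
- have m0 := mgf_gt0 x p01.
  (* One quarter minus the variance of the tilted Bernoulli law is a square. *)
  have -> : f' x = (1 - p - p * expR x) ^+ 2 / (4 * (mgf p x) ^+ 2).
    by rewrite /f' /mgf; field; exact: lt0r_neq0.
  by rewrite divr_ge0 ?sqr_ge0 // mulr_ge0 ?sqr_ge0.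
- rewrite /dlog /mgf expR0 mulr1 subrK invr1; ring.
Qed.

(** The gap between the two exponents vanishes at 0 together with its derivative [dlog], whose own
    derivative is nonnegative; [ge0_is_derive_ge0] is used twice. *)
Lemma bernoulli_mgf_le p y : 0 <= p <= 1 -> 0 <= y ->
  1 - p + p * expR y <= expR (p * y + y ^+ 2 / 8).
Proof.
move=> p01 y0; rewrite -[X in X <= _]lnK ?posrE ?mgf_gt0 // ler_expR -subr_ge0.
pose f x : R := p * x + x ^+ 2 / 8 - ln (mgf p x).
rewrite -/(f y); move: y y0; apply: (@ge0_is_derive_ge0 _ (dlog p)) => [x _|x x0|].
- have m0 := mgf_gt0 x p01.
  have h1 : is_derive x 1 (@ln R \o mgf p) ((mgf p x)^-1 * (p * expR x)).
    exact: is_derive1_comp (is_derive1_ln m0) (is_derive_mgf p x).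
  have h2 : is_derive x 1 (p \*: (id : R -> R^o)) (p *: (1 : R^o)).
    exact: is_deriveZ.
  have h3 : is_derive x 1 (8^-1 \*: ((fun x => x * x) : R -> R^o)) (8^-1 *: ((x *: 1 + x *: 1) : R^o)).
    by apply: is_deriveZ; exact: is_deriveM.
  have := is_deriveB (is_deriveD h2 h3) h1.
  rewrite (_ : p \*: id + 8^-1 \*: (fun x => x * x) - (@ln R \o mgf p) = f); last first.
    apply/funext => z; rewrite /f !fctE.
    change (p * z + 8^-1 * (z * z) - ln (mgf p z) = p * z + z ^+ 2 / 8 - ln (mgf p z)).
    ring.
  have -> : p *: 1 + 8^-1 *: (x *: 1 + x *: 1) - (mgf p x)^-1 * (p * expR x) = dlog p x.
    change (p * 1 + 8^-1 * (x * 1 + x * 1) - (mgf p x)^-1 * (p * expR x) = dlog p x).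
    by rewrite /dlog /mgf; field; exact: lt0r_neq0.
  by [].
- exact: dlog_ge0.
- by rewrite /f /mgf expR0 mulr1 subrK ln1 mulr0 expr0n mul0r subr0 addr0.
Qed.

Lemma expR_chord (t y : R) : 0 <= t <= 1 -> expR (t * y) <= 1 - t + t * expR y.
Proof.
move=> t01.
have := @convex_expR R (@Itv01 _ t (proj1 (andP t01)) (proj2 (andP t01))) y 0.
rewrite /= !convRE /= /unstable.onem expR0 mulr0 addr0 mulr1.
by rewrite addrC.
Qed.

(** By convexity of [expR], each value of [F] is replaced by a two-point law on [lo] and [lo + nu]
    with the same mean; this reduces the claim to a Bernoulli variable. *)
Lemma hoeffding_lower (X : finType) (P : fdist R X) (F : X -> R) (lo nu mu y : R) :
  0 < nu -> (forall i, lo <= F i <= lo + nu) -> 0 <= y ->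
  mu <= \sum_i P i * F i ->
  \sum_i P i * expR (- (y * F i)) <= expR (- (y * mu) + (y * nu) ^+ 2 / 8).
Proof.
move=> nu0 Fb y0 muF.
(* The weight of the lower end [lo]. *)
pose t i := (lo + nu - F i) / nu.
have t01 i : 0 <= t i <= 1.
  have /andP[l u] := Fb i.
  by rewrite /t ler_pdivrMr // mul1r divr_ge0 /= ?(ltW nu0) //; lra.
have FE i : - (y * F i) = - (y * (lo + nu)) + t i * (y * nu).
  by rewrite /t; field; exact: lt0r_neq0.
pose p := \sum_i P i * t i.
have p01 : 0 <= p <= 1.
  apply/andP; split; first apply: sumr_ge0.
    move=> i _; apply: mulr_ge0; [exact: Defs.pmf_ge0 | by case/andP: (t01 i)].
  apply: (@le_trans _ _ (\sum_i P i)); last by rewrite pmf_sum1.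
  apply: ler_sum => i _.
  by apply: ler_piMr; [exact: Defs.pmf_ge0 | by case/andP: (t01 i)].
have pE : p = (lo + nu - \sum_i P i * F i) / nu.
  have -> : lo + nu = \sum_i P i * (lo + nu) by rewrite -mulr_suml pmf_sum1 mul1r.
  rewrite /p -sumrB mulr_suml.
  by apply: eq_bigr => i _; rewrite /t; ring.
apply: (@le_trans _ _ (expR (- (y * (lo + nu))) * (1 - p + p * expR (y * nu)))).
  have -> : 1 - p + p * expR (y * nu) = \sum_i P i * (1 - t i + t i * expR (y * nu)).
    transitivity (\sum_i (P i - P i * t i + P i * t i * expR (y * nu))).
      by rewrite big_split /= sumrB pmf_sum1 -mulr_suml.
    by apply: eq_bigr => i _; ring.
  rewrite mulr_sumr; apply: ler_sum => i _.
  rewrite FE expRD mulrCA; apply: ler_wpM2l; first exact: expR_ge0.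
  by apply: ler_wpM2l; [exact: Defs.pmf_ge0 | exact: expR_chord].
apply: (@le_trans _ _ (expR (- (y * (lo + nu))) * expR (p * (y * nu) + (y * nu) ^+ 2 / 8))).
  by rewrite ler_wpM2l ?expR_ge0 // bernoulli_mgf_le // mulr_ge0 // ltW.
rewrite -expRD ler_expR addrA lerD2r pE.
have -> : (lo + nu - \sum_i P i * F i) / nu * (y * nu) = y * (lo + nu) - y * \sum_i P i * F i.
  by field; exact: lt0r_neq0.
by rewrite addrA addNr add0r lerN2 ler_wpM2l.
Qed.

End Hoeffding.

(** * Expected rewards and optimal values *)

Section Expectation.
Context (R : realType) (A O S : finType).
Context (rho : environment R A O) (S0 : S) (f : S -> A -> O -> S)
  (r : S -> A -> O -> R).
Implicit Types (pi : policy R A O) (h : history A O).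

Local Notation phi := (phi S0 f).
Local Notation expect := (expect rho).
Local Notation reward := (reward S0 f r).
Local Notation mean_reward := (mean_reward rho S0 f r).

Lemma phi_rcons h ao : phi (rcons h ao) = f (phi h) ao.1 ao.2.
Proof. by rewrite /Defs.phi -cats1 foldl_cat. Qed.

Lemma expect_cons pi h n (F : n.+1.-tuple (A * O) -> R) :
  expect pi h F = \sum_a pi h a * \sum_o rho h a o *
    expect pi (rcons h (a, o)) (fun w => F [tuple of (a, o) :: w]).
Proof.
rewrite /Defs.expect.
rewrite (reindex (fun p : (A * O) * n.-tuple (A * O) => [tuple of p.1 :: p.2])) /=; last first.
  exists (fun w : n.+1.-tuple (A * O) => (thead w, [tuple of behead w])) => [[x w] _|w _] /=.
    by congr pair; exact/val_inj.
  by rewrite [RHS]tuple_eta; exact/val_inj.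
rewrite -(pair_bigA _ (fun x (w : n.-tuple (A * O)) => path_prob rho pi h (x :: w) * F [tuple of x :: w])) /=.
under [RHS]eq_bigr => a _ do rewrite mulr_sumr.
rewrite [RHS]pair_bigA /=; apply: eq_bigr => -[a o] _ /=.
by rewrite !mulr_sumr; apply: eq_bigr => w _; rewrite !mulrA.
Qed.

Lemma expect_nil pi h (F : 0.-tuple (A * O) -> R) : expect pi h F = F [tuple].
Proof.
rewrite /Defs.expect (big_pred1 [tuple]) => [|w]; first by rewrite /= mul1r.
by rewrite [w]tuple0; apply/esym/eqP/val_inj.
Qed.

Lemma expect_cst pi h n (c : R) : expect pi h (fun _ : n.-tuple (A * O) => c) = c.
Proof.
elim: n h => [|n IH] h; first by rewrite expect_nil.
rewrite expect_cons.
under eq_bigr => a _ do (under eq_bigr => o _ do rewrite IH; rewrite -mulr_suml pmf_sum1 mul1r).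
by rewrite -mulr_suml pmf_sum1 mul1r.
Qed.

Lemma eq_expect pi h n (F G : n.-tuple (A * O) -> R) : F =1 G ->
  expect pi h F = expect pi h G.
Proof. by move=> FG; apply: eq_bigr => w _; rewrite FG. Qed.

Lemma expect_sum pi h n (I : finType) (c : I -> R) (F : I -> n.-tuple (A * O) -> R) :
  expect pi h (fun w => \sum_i c i * F i w) = \sum_i c i * expect pi h (F i).
Proof.
rewrite /Defs.expect; under eq_bigr => w _ do rewrite mulr_sumr.
rewrite exchange_big /=; apply: eq_bigr => i _; rewrite mulr_sumr.
by apply: eq_bigr => w _; rewrite mulrCA.
Qed.

(** Conditioning on the first step replaces sums over tuples; average rewards, discounted values and
    regret are all linear in these numbers. *)
Fixpoint exp_reward pi (k : nat) h : R :=
  if k is k'.+1 then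
    \sum_a pi h a * \sum_o rho h a o * exp_reward pi k' (rcons h (a, o))
  else \sum_a pi h a * mean_reward h a.

Lemma expect_reward pi h n (k : 'I_n) :
  expect pi h (fun w : n.-tuple (A * O) => reward h w k) = exp_reward pi k h.
Proof.
elim: n h k => [|n IH] h k; first by case: k.
rewrite expect_cons; case: (unliftP ord0 k) => [j ->|->] /=.
- apply: eq_bigr => a _; congr (_ * _); apply: eq_bigr => o _; congr (_ * _).
  rewrite -IH; apply: eq_expect => w.
  by rewrite /Defs.reward /= !tnthS /= cat_rcons.
- apply: eq_bigr => a _; congr (_ * _); apply: eq_bigr => o _; congr (_ * _).
  rewrite (eq_expect _ _ (G := fun _ => r (phi h) a o)) ?expect_cst // => w.
  by rewrite /Defs.reward /= ?take0 ?cats0 ?(tnth_nth (a, o)).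
Qed.

Lemma avg_reward_fromE pi h T :
  avg_reward_from rho S0 f r pi h T = T%:R^-1 * \sum_(k < T) exp_reward pi k h.
Proof.
rewrite /avg_reward_from.
rewrite (eq_expect _ _ (G := fun w => \sum_(t < T) T%:R^-1 * reward h w t)); last first.
  by move=> w; rewrite mulr_sumr.
by rewrite expect_sum mulr_sumr; apply: eq_bigr => k _; rewrite expect_reward.
Qed.

Lemma VE gamma pi h : V rho S0 f r gamma pi h =
  limn (fun n => \sum_(k < n) gamma ^+ k * exp_reward pi k h).
Proof.
congr (limn _); apply/funext => n; rewrite expect_sum.
by apply: eq_bigr => k _; rewrite expect_reward.
Qed.

Lemma regretE agent pi T : regret rho S0 f r agent pi T =
  \sum_(k < T) (avg_reward rho S0 f r pi - exp_reward agent k [::]).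
Proof.
rewrite /regret.
(* A difference is a sum over booleans with weights 1 and -1, so [expect_sum] covers it. *)
pose c (b : bool) : R := if b then 1 else -1.
rewrite (eq_expect _ _ (G := fun w => \sum_(t < T) 1 * (avg_reward rho S0 f r pi - reward [::] w t))); last first.
  by move=> w; apply: eq_bigr => t _; rewrite mul1r.
rewrite expect_sum; apply: eq_bigr => k _; rewrite mul1r.
rewrite (eq_expect _ _ (G := fun w => \sum_(b : bool) c b * (if b then avg_reward rho S0 f r pi else reward [::] w k))); last first.
  by move=> w; rewrite big_bool /c mul1r mulN1r.
by rewrite expect_sum big_bool /c expect_cst expect_reward mul1r mulN1r.
Qed.

End Expectation.

Section Values.
Local Open Scope classical_set_scope.
Context (R : realType) (A O S : finType) (a0 : A).
Context (rho : environment R A O) (S0 : S) (f : S -> A -> O -> S)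
  (r : S -> A -> O -> R) (hr : forall s a o, 0 <= r s a o <= 1).
Implicit Types (pi : policy R A O) (h : history A O).

Local Notation phi := (phi S0 f).
Local Notation mean_reward := (mean_reward rho S0 f r).
Local Notation exp_reward := (exp_reward rho S0 f r).
Local Notation V := (V rho S0 f r).
Local Notation Q := (Q rho S0 f r).
Local Notation Qstar := (Qstar rho S0 f r).

Lemma fdist_ge0 (X : finType) (P : fdist R X) x : 0 <= P x.
Proof. exact: Defs.pmf_ge0. Qed.

Lemma fdist_mean_cst (X : finType) (P : fdist R X) (c : R) : \sum_x P x * c = c.
Proof. by rewrite -mulr_suml pmf_sum1 mul1r. Qed.

Lemma fdist_mean_le (X : finType) (P : fdist R X) (F G : X -> R) :
  (forall x, F x <= G x) -> \sum_x P x * F x <= \sum_x P x * G x.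
Proof. by move=> FG; apply: ler_sum => x _; rewrite ler_wpM2l ?fdist_ge0. Qed.

Lemma fdist_mean_bound (X : finType) (P : fdist R X) (F : X -> R) (l u : R) :
  (forall x, l <= F x <= u) -> l <= \sum_x P x * F x <= u.
Proof.
move=> Fb; apply/andP; split.
  by rewrite -[leLHS](fdist_mean_cst P); apply: fdist_mean_le => x; case/andP: (Fb x).
by rewrite -[leRHS](fdist_mean_cst P); apply: fdist_mean_le => x; case/andP: (Fb x).
Qed.

Lemma mean_reward_bound h a : 0 <= mean_reward h a <= 1.
Proof. by apply: fdist_mean_bound => o. Qed.

Lemma exp_reward_bound pi k h : 0 <= exp_reward pi k h <= 1.
Proof.
elim: k h => [|k IH] h /=; apply: fdist_mean_bound => a.
  exact: mean_reward_bound.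
by apply: fdist_mean_bound => o.
Qed.

Definition disc_reward gamma pi n h := \sum_(k < n) gamma ^+ k * exp_reward pi k h.

Lemma disc_rewardS gamma pi n h : disc_reward gamma pi n.+1 h =
  \sum_a pi h a * (mean_reward h a +
    gamma * \sum_o rho h a o * disc_reward gamma pi n (rcons h (a, o))).
Proof.
rewrite /disc_reward big_ord_recl /= expr0 mul1r.
under [RHS]eq_bigr => a _ do rewrite mulrDr.
rewrite big_split /=; congr (_ + _).
under eq_bigr => k _ do rewrite mulr_sumr.
rewrite exchange_big /=; apply: eq_bigr => a _.
rewrite mulr_sumr mulr_sumr.
under eq_bigr => k _ do rewrite !mulr_sumr.
rewrite exchange_big /=; apply: eq_bigr => o _.
rewrite !mulr_sumr; apply: eq_bigr => k _.
by rewrite /bump /= exprS; ring.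
Qed.

(** * Values at a fixed discount factor *)

Section Discount.
Context (gamma : R) (g01 : 0 <= gamma < 1).

Let g0 : 0 <= gamma. Proof. by case/andP: g01. Qed.
Let g1 : 0 < 1 - gamma. Proof. by rewrite subr_gt0; case/andP: g01. Qed.

Lemma geometric_sum n : \sum_(k < n) gamma ^+ k = (1 - gamma ^+ n) / (1 - gamma).
Proof.
apply: (mulIf (lt0r_neq0 g1)); rewrite mulfVK ?lt0r_neq0 //.
by rewrite -[X in X - gamma ^+ n](expr1n R n) subrXX mulrC; congr (_ * _); apply: eq_bigr => k _; rewrite expr1n mul1r.
Qed.

Lemma disc_reward_ge0 pi n h : 0 <= disc_reward gamma pi n h.
Proof.
apply: sumr_ge0 => k _; apply: mulr_ge0; first exact: exprn_ge0.
by case/andP: (exp_reward_bound pi k h).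
Qed.

Lemma disc_reward_le pi n h : disc_reward gamma pi n h <= (1 - gamma)^-1.
Proof.
apply: (@le_trans _ _ (\sum_(k < n) gamma ^+ k)).
  apply: ler_sum => k _; apply: ler_piMr; first exact: exprn_ge0.
  by case/andP: (exp_reward_bound pi k h).
rewrite geometric_sum -[leRHS]mul1r; apply: ler_wpM2r; first by rewrite invr_ge0 ltW.
by rewrite lerBlDr lerDl exprn_ge0.
Qed.

Let cvg_disc_reward pi h : cvgn (fun n => disc_reward gamma pi n h).
Proof.
apply: nondecreasing_is_cvgn.
  apply/nondecreasing_seqP => n; rewrite /disc_reward big_ord_recr /= lerDl.
  apply: mulr_ge0; first exact: exprn_ge0.
  by case/andP: (exp_reward_bound pi n h).
by exists (1 - gamma)^-1 => _ [n _ <-]; exact: disc_reward_le.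
Qed.

Lemma disc_reward_le_V pi n h : disc_reward gamma pi n h <= V gamma pi h.
Proof.
rewrite VE; apply: (@nondecreasing_cvgn_le R (fun n => disc_reward gamma pi n h) _ (@cvg_disc_reward pi h) n).
apply/nondecreasing_seqP => m; rewrite /disc_reward big_ord_recr /= lerDl.
apply: mulr_ge0; first exact: exprn_ge0.
by case/andP: (exp_reward_bound pi m h).
Qed.

Lemma V_le pi h B : (forall n, disc_reward gamma pi n h <= B) -> V gamma pi h <= B.
Proof.
move=> leB; rewrite VE; apply: limr_le; first exact: cvg_disc_reward.
exact: nearW.
Qed.

Lemma V_bound pi h : 0 <= V gamma pi h <= (1 - gamma)^-1.
Proof.
rewrite (le_trans (disc_reward_ge0 pi 0 h) (disc_reward_le_V _ _ _)) /=.
by apply: V_le => n; exact: disc_reward_le.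
Qed.

Lemma Q_bound pi h a : 0 <= Q gamma pi h a <= (1 - gamma)^-1.
Proof.
have /andP[m0 m1] := mean_reward_bound h a.
have /andP[v0 v1] := @fdist_mean_bound O (rho h a) (fun o => V gamma pi (rcons h (a, o))) _ _ (fun o => V_bound pi _).
rewrite /Defs.Q addr_ge0 ?mulr_ge0 //=.
have -> : (1 - gamma)^-1 = 1 + gamma * (1 - gamma)^-1 by field; rewrite lt0r_neq0.
by rewrite lerD // ler_wpM2l.
Qed.

Lemma Q_le_Qstar pi h a : Q gamma pi h a <= Qstar gamma h a.
Proof.
apply: ub_le_sup; last by exists pi.
by exists (1 - gamma)^-1 => _ [p _ <-]; case/andP: (Q_bound p h a).
Qed.

Definition uniform_policy : policy R A O := fun _ => unif R (greedy_gt0 a0 (fun _ => 0 : R)).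

Lemma Qstar_le h a B : (forall pi, Q gamma pi h a <= B) -> Qstar gamma h a <= B.
Proof.
move=> leB; apply: ge_sup; first by exists (Q gamma uniform_policy h a), uniform_policy.
by move=> _ [p _ <-].
Qed.

Lemma Qstar_bound h a : 0 <= Qstar gamma h a <= (1 - gamma)^-1.
Proof.
rewrite (le_trans _ (Q_le_Qstar uniform_policy h a)) /=; last by case/andP: (Q_bound uniform_policy h a).
by apply: Qstar_le => p; case/andP: (Q_bound p h a).
Qed.

Definition Vstar h := max_action a0 (Qstar gamma h).

Lemma le_max_action (q : A -> R) a : q a <= max_action a0 q.
Proof. exact: le_bigmax. Qed.

Lemma max_action_le (q : A -> R) B : (forall a, q a <= B) -> max_action a0 q <= B.
Proof. by move=> qB; apply/bigmax_leP; split. Qed.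

Lemma max_action_ex (q : A -> R) : exists a, max_action a0 q = q a.
Proof.
have /card_gt0P[a] := greedy_gt0 a0 q.
by rewrite inE => /eqP; exists a.
Qed.

(** A truncated discounted sum decomposes over the first action by [disc_rewardS]; its continuation
    is at most [V], so each term is at most some [Q gamma pi h a]. *)
Lemma V_le_Vstar pi h : V gamma pi h <= Vstar h.
Proof.
apply: V_le => -[|n].
  rewrite /disc_reward big_ord0 (le_trans _ (le_max_action _ a0)) //.
  by case/andP: (Qstar_bound h a0).
rewrite disc_rewardS.
rewrite -[leRHS](fdist_mean_cst (pi h)).
apply: fdist_mean_le => a.
rewrite (le_trans _ (le_max_action _ a)) // (le_trans _ (Q_le_Qstar pi h a)) //.
rewrite /Defs.Q lerD2l ler_wpM2l //; apply: fdist_mean_le => o.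
exact: disc_reward_le_V.
Qed.

Lemma Vstar_bound h : 0 <= Vstar h <= (1 - gamma)^-1.
Proof.
rewrite max_action_le ?andbT => [|a]; last by case/andP: (Qstar_bound h a).
rewrite (le_trans _ (le_max_action _ a0)) //.
by case/andP: (Qstar_bound h a0).
Qed.

(** This half of the optimality equation is obtained policy by policy, without constructing an
    optimal policy. *)
Lemma Qstar_Bellman h a :
  Qstar gamma h a <= mean_reward h a + gamma * \sum_o rho h a o * Vstar (rcons h (a, o)).
Proof.
apply: Qstar_le => pi; rewrite /Defs.Q lerD2l ler_wpM2l //.
by apply: fdist_mean_le => o; exact: V_le_Vstar.
Qed.

End Discount.

(** Rewards are at most 1, so a larger discount factor adds at most the difference of the two
    geometric series. *)
Lemma Qstar_incr g1 g2 h a : 0 <= g1 -> g1 <= g2 -> g2 < 1 ->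
  Qstar g2 h a <= Qstar g1 h a + ((1 - g2)^-1 - (1 - g1)^-1).
Proof.
move=> g10 g12 g21; have g11 := le_lt_trans g12 g21.
have g1P : 0 <= g1 < 1 by rewrite g10.
have g2P : 0 <= g2 < 1 by rewrite g21 (le_trans g10).
have d1 : 0 < 1 - g1 by rewrite subr_gt0.
have d2 : 0 < 1 - g2 by rewrite subr_gt0.
have key pi h' : g2 * V g2 pi h' <= g1 * V g1 pi h' + ((1 - g2)^-1 - (1 - g1)^-1).
  have [g2E|g2N] := eqVneq g2 0.
    have -> : g1 = 0 by lra.
    by rewrite g2E !mul0r subrr addr0.
  have g20 : 0 < g2 by rewrite lt_neqAle eq_sym g2N; case/andP: g2P.
  rewrite -ler_pdivlMl // mulrC; apply: (V_le g2P) => n; rewrite ler_pdivlMr // mulrC.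
  apply: (@le_trans _ _ (g1 * disc_reward g1 pi n h' + ((1 - g2)^-1 - (1 - g1)^-1))); last first.
    by rewrite lerD2r ler_wpM2l // disc_reward_le_V.
  rewrite -lerBlDl /disc_reward !mulr_sumr -sumrB.
  apply: (@le_trans _ _ (g2 * \sum_(k < n) g2 ^+ k - g1 * \sum_(k < n) g1 ^+ k)).
    rewrite !mulr_sumr -sumrB; apply: ler_sum => k _.
    rewrite !mulrA -!exprS -mulrBl ler_piMr //; last by case/andP: (exp_reward_bound pi k h').
    by rewrite subr_ge0 lerXn2r // nnegrE ltW.
  rewrite !geometric_sum //.
  have -> : g2 * ((1 - g2 ^+ n) / (1 - g2)) - g1 * ((1 - g1 ^+ n) / (1 - g1)) =
    (1 - g2)^-1 - (1 - g1)^-1 - (g2 ^+ n.+1 / (1 - g2) - g1 ^+ n.+1 / (1 - g1)).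
    by rewrite !exprS; field; rewrite !lt0r_neq0.
  (* The tail cut off at [n] is larger for [g2] than for [g1], hence the truncated difference is
     below the full one. *)
  rewrite lerBlDr lerDl subr_ge0; apply: ler_pM.
  - exact: exprn_ge0.
  - by rewrite invr_ge0 ltW.
  - by rewrite lerXn2r // nnegrE ltW.
  - by rewrite lef_pV2 ?posrE // lerB.
apply: Qstar_le => pi.
apply: (@le_trans _ _ (Q g1 pi h a + ((1 - g2)^-1 - (1 - g1)^-1))); last by rewrite lerD2r Q_le_Qstar.
rewrite /Defs.Q -addrA lerD2l !mulr_sumr.
rewrite -[X in _ <= _ + X](fdist_mean_cst (rho h a)) -big_split /=.
apply: ler_sum => o _.
by rewrite mulrCA [g1 * _]mulrCA -mulrDr ler_wpM2l ?fdist_ge0.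
Qed.

(** Summation by parts against the nonincreasing weights [g ^+ k], which start at 1. *)
Lemma abel_lower (g tp : R) (c : nat -> R) n : 0 <= g <= 1 -> 0 <= tp ->
  (forall m, - tp <= \sum_(k < m) c k) -> - tp <= \sum_(k < n) g ^+ k * c k.
Proof.
move=> /andP[g0 g1] tp0 cP.
(* The last partial sum keeps weight [g ^+ m]; the decrements of the weights add up to [1 - g ^+ m]
   and each multiplies a partial sum that is at least [- tp]. *)
suff : forall m, g ^+ m * (\sum_(k < m.+1) c k) - tp * (1 - g ^+ m) <= \sum_(k < m.+1) g ^+ k * c k.
  case: n => [|n] H; first by rewrite big_ord0 oppr_le0.
  apply: le_trans (H n); have := cP n.+1; have : 0 <= g ^+ n by exact: exprn_ge0.
  move: (\sum_(k < n.+1) c k) (g ^+ n) => s x x0 s0; nra.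
elim=> [|m IH]; first by rewrite !big_ord_recr !big_ord0 /= expr0 subrr mulr0 subr0 !mul1r.
rewrite big_ord_recr [leRHS]big_ord_recr /=.
apply: le_trans (lerD IH (lexx _)).
have := cP m.+1; have x0 : 0 <= g ^+ m by exact: exprn_ge0.
rewrite [g ^+ m.+1]exprS; move: (\sum_(k < m.+1) c k) (g ^+ m) x0 (c m.+1) => s x x0 y s0.
have : 0 <= (1 - g) * x by rewrite mulr_ge0 // subr_ge0.
nra.
Qed.

(** * Values of a policy with finite averaging time *)

Section AveragingTime.
Context (pi : policy R A O) (lam tp : R).
Hypothesis tp0 : 0 <= tp.
Hypothesis avgP : forall h T, (1 <= T)%N ->
  `|avg_reward_from rho S0 f r pi h T - lam| <= tp / T%:R.

Lemma sum_exp_reward_dev h T : `|\sum_(k < T) (exp_reward pi k h - lam)| <= tp.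
Proof.
case: T => [|T]; first by rewrite big_ord0 normr0.
have := avgP h (ltn0Sn T); rewrite avg_reward_fromE sumrB sumr_const card_ord -[lam *+ _]mulr_natl.
have T0 : 0 < T.+1%:R :> R by rewrite ltr0n.
set s := \sum_(k < T.+1) _.
have -> : T.+1%:R^-1 * s - lam = (s - T.+1%:R * lam) / T.+1%:R.
  by field; rewrite lt0r_neq0.
by rewrite normrM normfV (gtr0_norm T0) ler_pdivlMr // mulfVK ?lt0r_neq0.
Qed.

(** Averages of rewards lie in [0, 1] and are within [tp / T] of [lam], for [T] as large as
    desired. *)
Lemma lam_bound : 0 <= lam <= 1.
Proof.
have bnd (e : R) : 0 < e -> - e <= lam <= 1 + e.
  move=> e0; have [T T0 Te] : exists2 T, (0 < T)%N & tp / T%:R <= e.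
    exists (Num.bound (tp / e)).+1 => //.
    rewrite ler_pdivrMr ?ltr0n // mulrC -ler_pdivrMr //.
    have := archi_boundP (divr_ge0 tp0 (ltW e0)) => /ltW /le_trans; apply.
    by rewrite ler_nat.
  have := avgP [::] T0; rewrite ler_distlC avg_reward_fromE.
  have T1 : 0 < T%:R :> R by rewrite ltr0n.
  have a0' : 0 <= T%:R^-1 * \sum_(k < T) exp_reward pi k [::].
    apply: mulr_ge0; first by rewrite invr_ge0 ltW.
    by apply: sumr_ge0 => k _; case/andP: (exp_reward_bound pi k [::]).
  have a1' : T%:R^-1 * \sum_(k < T) exp_reward pi k [::] <= 1.
    rewrite ler_pdivrMl // mulr1; apply: (@le_trans _ _ (\sum_(k < T) 1)).
      by apply: ler_sum => k _; case/andP: (exp_reward_bound pi k [::]).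
    by rewrite sumr_const card_ord.
  move=> /andP[]; lra.
apply/andP; split.
- by apply/ler_addgt0Pr => e e0; have /andP[] := bnd e e0; lra.
- by apply/ler_addgt0Pr => e e0; have /andP[] := bnd e e0; lra.
Qed.

(** [abel_lower] is applied to the centered rewards, whose partial sums stay within [tp]; the
    truncated series of [lam] misses its limit by a multiple of [g ^+ n]. *)
Lemma V_lower g h : 0 <= g < 1 -> lam * (1 - g)^-1 - tp <= V g pi h.
Proof.
move=> g01; have /andP[g0 g1] := g01; have d : 0 < 1 - g by rewrite subr_gt0.
have /andP[l0 l1] := lam_bound.
have low n : lam * (1 - g)^-1 - tp - V g pi h <= lam * (1 - g)^-1 * g ^+ n.
  have := @abel_lower g tp (fun k => exp_reward pi k h - lam) n.
  rewrite g0 ltW // => /(_ isT tp0) H.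
  have {}H : - tp <= \sum_(k < n) g ^+ k * (exp_reward pi k h - lam).
    by apply: H => m; have := sum_exp_reward_dev h m; rewrite ler_norml => /andP[].
  have := disc_reward_le_V g01 pi n h; move: H.
  under eq_bigr => k _ do rewrite mulrBr.
  rewrite sumrB -/(disc_reward g pi n h) -mulr_suml geometric_sum //.
  move: (disc_reward _ _ _ _) (V _ _ _) => x y.
  have -> : (1 - g ^+ n) / (1 - g) * lam = lam * (1 - g)^-1 - lam * (1 - g)^-1 * g ^+ n by ring.
  lra.
have cv : (fun n => lam * (1 - g)^-1 * g ^+ n) @ \oo --> (0 : R).
  rewrite -[X in _ --> X](mulr0 (lam * (1 - g)^-1)); apply: cvgMr.
  by apply: cvg_expr; rewrite ger0_norm.
rewrite -subr_le0 -(cvg_lim _ cv) //; apply: limr_ge; first by apply: cvgP cv.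
exact: nearW.
Qed.

End AveragingTime.
End Values.

(** * The reference table *)

Section Reference.
Local Open Scope classical_set_scope.
Context (R : realType) (A O S : finType) (a0 : A).
Context (rho : environment R A O) (S0 : S) (f : S -> A -> O -> S)
  (r : S -> A -> O -> R) (hr : forall s a o, 0 <= r s a o <= 1).
Context (pi : policy R A O) (lam tp : R).
Hypothesis tp0 : 0 <= tp.
Hypothesis avgP : forall h T, (1 <= T)%N ->
  `|avg_reward_from rho S0 f r pi h T - lam| <= tp / T%:R.

Local Notation phi := (phi S0 f).
Local Notation mean_reward := (mean_reward rho S0 f r).
Local Notation Qstar := (Qstar rho S0 f r).
Local Notation Vstar := (Vstar a0 rho S0 f r).
Implicit Types (u : R) (h : history A O).

(** A lower bound on all optimal values at horizon [u]: the first term comes from the comparison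
    policy through [V_lower], the second from nonnegative rewards. *)
Definition vlow u := Num.max (lam * u - tp) 0.

(* Optimality at the shorter horizon u, shifted by a constant that makes it a
   subsolution of the Bellman equation at the horizon (21/20) u. *)
Definition qref u s a :=
  20^-1 * vlow u + sup [set Qstar (1 - u^-1) h a | h in [set h | phi h = s]].

(** The value at the next history in the Bellman inequality for [qref]; it carries the same
    shift. *)
Definition vref u h := 20^-1 * vlow u + Vstar (1 - u^-1) h.

Section Horizon.
Context (u : R) (u1 : 1 <= u).

Let u0 : 0 < u. Proof. exact: lt_le_trans u1. Qed.

Let g01 : 0 <= 1 - u^-1 < 1.
Proof. by rewrite subr_ge0 invf_le1 // u1 /= ltrBlDr ltrDl invr_gt0. Qed.

Let invE : (1 - (1 - u^-1))^-1 = u.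
Proof. by rewrite opprB addrC subrK invrK. Qed.

Lemma vlow_bound : 0 <= vlow u <= u.
Proof.
have /andP[l0 l1] := lam_bound hr tp0 avgP.
rewrite /vlow le_max lexx orbT ge_max (ltW u0) andbT /=.
have : lam * u <= u by rewrite ler_piMl // ltW.
have := tp0; lra.
Qed.

Lemma vlow_le_Vstar h : vlow u <= Vstar (1 - u^-1) h.
Proof.
rewrite /vlow ge_max; have /andP[-> _] := Vstar_bound a0 rho S0 f hr g01 h.
rewrite andbT; apply: le_trans (V_le_Vstar a0 rho S0 f hr g01 pi h).
by have := V_lower hr tp0 avgP h g01; rewrite invE.
Qed.

(** These bounds become [Wlo] and [Whi] in the analysis of an epoch. The upper one plus a twentieth
    of their gap is exactly [21 / 20 * u], the truncation level: this is the margin. *)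
Lemma vref_bound h : 20^-1 * vlow u + vlow u <= vref u h <= 20^-1 * vlow u + u.
Proof.
rewrite /vref !lerD2l vlow_le_Vstar /=.
by have /andP[_] := Vstar_bound a0 rho S0 f hr g01 h; rewrite invE.
Qed.

Let Qstar_ubound s a :
  ubound [set Qstar (1 - u^-1) h a | h in [set h | phi h = s]] u.
Proof. by move=> _ [h _ <-]; have /andP[_] := Qstar_bound a0 rho S0 f hr g01 h a; rewrite invE. Qed.

Lemma qref_le s a : qref u s a <= 20^-1 * vlow u + u.
Proof.
rewrite /qref lerD2l; set E := [set _ | _ in _].
have [E0|E0] := pselect (E !=set0).
  by apply: ge_sup => //; exact: Qstar_ubound.
(* Outside the range of [phi] the set is empty and [sup] takes its default value 0. *)
by rewrite sup_out ?ltW // => -[].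
Qed.

Lemma Qstar_le_sup h a :
  Qstar (1 - u^-1) h a <= sup [set Qstar (1 - u^-1) h' a | h' in [set h' | phi h' = phi h]].
Proof.
apply: ub_le_sup; last by exists h.
by exists u; exact: Qstar_ubound.
Qed.

Lemma vref_le_qref h : exists a, vref u h <= qref u (phi h) a.
Proof.
have [a aE] := max_action_ex a0 (Qstar (1 - u^-1) h).
exists a; rewrite /vref /qref lerD2l.
have -> : Vstar (1 - u^-1) h = Qstar (1 - u^-1) h a by exact: aE.
exact: Qstar_le_sup.
Qed.

Lemma sup_le_Qstar h a : sup [set Qstar (1 - u^-1) h' a | h' in [set h' | phi h' = phi h]]
   - distortion rho S0 f r u <= Qstar (1 - u^-1) h a.
Proof.
rewrite lerBlDr -lerBlDl.
set I := inf [set Qstar (1 - u^-1) h' a | h' in [set h' | phi h' = phi h]].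
have IQ : I <= Qstar (1 - u^-1) h a.
  apply: ge_inf; last by exists h.
  by exists 0 => _ [h' _ <-]; have /andP[] := Qstar_bound a0 rho S0 f hr g01 h' a.
rewrite (le_trans (lerB (lexx _) IQ)) // /distortion.
apply: (le_bigmax_cond _ (fun sa : S * A => sup [set Qstar (1 - u^-1) h sa.2 | h in [set h | phi h = sa.1]] -
     inf [set Qstar (1 - u^-1) h sa.2 | h in [set h | phi h = sa.1]]) (j := (phi h, a))).
by apply/asboolP; exists h.
Qed.

(** With [v] the mean of [Vstar] at the next history, passing from discount [1 - u^-1] to
    [1 - tau^-1] gains [v / (20 * tau)], and discounting the shift loses [vlow u / (20 * tau)]; the
    gain wins since [vlow u <= v]. The distortion pays for the supremum over histories. *)
Lemma qref_Bellman h a (tau := 21 / 20 * u) :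
  qref u (phi h) a - distortion rho S0 f r u <=
  \sum_o rho h a o * (r (phi h) a o + (1 - tau^-1) * vref u (rcons h (a, o))).
Proof.
have H1 := sup_le_Qstar h a; have H2 := Qstar_Bellman a0 rho S0 f hr g01 h a.
have H3 : vlow u <= \sum_o rho h a o * Vstar (1 - u^-1) (rcons h (a, o)).
  rewrite -[leLHS](fdist_mean_cst (rho h a)); apply: fdist_mean_le => o.
  exact: vlow_le_Vstar.
have -> : \sum_o rho h a o * (r (phi h) a o + (1 - tau^-1) * vref u (rcons h (a, o))) =
  mean_reward h a + (1 - tau^-1) * (20^-1 * vlow u + \sum_o rho h a o * Vstar (1 - u^-1) (rcons h (a, o))).
  rewrite -[20^-1 * vlow u in RHS](fdist_mean_cst (rho h a)) -big_split /= mulr_sumr -big_split /=.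
  by apply: eq_bigr => o _; rewrite /vref; ring.
rewrite /qref; set s := sup _ in H1 *; set D := distortion _ _ _ _ _ in H1 *.
move: H1 H2 H3; rewrite /tau; set v := \sum_o _; set q := Qstar _ _ _.
have -> : (21 / 20 * u)^-1 = 20 / 21 * u^-1 by field; exact: lt0r_neq0.
have : 0 < u^-1 by rewrite invr_gt0.
move: (mean_reward h a) (vlow u) (u^-1) => mr v0 i i0 H1 H2 H3.
have : 0 <= i * (v - v0) by rewrite mulr_ge0 ?subr_ge0 // ltW.
lra.
Qed.

End Horizon.

(** The supremum contributes at most [u2 - u1] and the shift a twentieth of that. In terms of the
    horizons [21 / 20 * u], the total is exactly what the algorithm adds to its table. *)
Lemma qref_incr u1 u2 s a : 1 <= u1 -> u1 <= u2 ->
  qref u2 s a <= qref u1 s a + 21 / 20 * (u2 - u1).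
Proof.
move=> u11 u12; have u10 : 0 < u1 by exact: lt_le_trans u11.
have u20 : 0 < u2 by exact: lt_le_trans u12.
have /andP[l0 l1] := lam_bound hr tp0 avgP.
have Hv : vlow u2 <= vlow u1 + (u2 - u1).
  have lu : lam * (u2 - u1) <= u2 - u1 by rewrite ler_piMl // subr_ge0.
  rewrite /vlow ge_max; apply/andP; split.
    have : lam * u1 - tp <= Num.max (lam * u1 - tp) 0 by rewrite le_max lexx.
    by move: (Num.max _ _) => m; nra.
  have : 0 <= Num.max (lam * u1 - tp) 0 by rewrite le_max lexx orbT.
  by lra.
suff : sup [set Qstar (1 - u2^-1) h a | h in [set h | phi h = s]] <=
  sup [set Qstar (1 - u1^-1) h a | h in [set h | phi h = s]] + (u2 - u1).
  by rewrite /qref; lra.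
have [[h /= hs]|NE] := pselect ([set h | phi h = s] !=set0).
  apply: ge_sup; first by exists (Qstar (1 - u2^-1) h a), h.
  move=> _ [h' /= h's <-].
  have := Qstar_incr a0 rho S0 f hr (g1 := 1 - u1^-1) (g2 := 1 - u2^-1) h' a.
  rewrite !(opprB 1) ![1 + _]addrC !subrK !invrK => H.
  apply: le_trans (H _ _ _) _.
  - by rewrite addrC subr_ge0 invf_le1.
  - by rewrite lerD2r lerN2 lef_pV2.
  - by rewrite addrC ltrBlDr ltrDl invr_gt0.
  by rewrite lerD2r -h's addrC; exact: Qstar_le_sup.
(* For a state outside the range of [phi] both suprema are 0. *)
have -> : [set h | phi h = s] = set0.
  by apply/seteqP; split => // h hs; case: NE; exists h.
by rewrite !image_set0 sup0 add0r subr_ge0.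
Qed.

End Reference.

(** * One epoch *)

Section Scalars.
Context (R : realType).
Implicit Types (tau beta l : R) (n : nat).

(** Cauchy-Schwarz against the constant 1, from the nonnegativity of the sum of squared deviations
    from the mean, scaled by the cardinal. *)
Lemma sqr_sum_le (I : finType) (x : I -> R) :
  (\sum_i x i) ^+ 2 <= #|I|%:R * \sum_i x i ^+ 2.
Proof.
set s := \sum_i x i; set q := \sum_i _.
have [I0|I0] := posnP #|I|.
  by rewrite /s big_pred0 ?expr0n ?I0 ?mul0r // => i; have := fintype0 i I0.
have : 0 <= \sum_i (#|I|%:R * x i - s) ^+ 2 by apply: sumr_ge0 => i _; exact: sqr_ge0.
have -> : \sum_i (#|I|%:R * x i - s) ^+ 2 = #|I|%:R * (#|I|%:R * q - s ^+ 2).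
  rewrite (eq_bigr (fun i => #|I|%:R ^+ 2 * x i ^+ 2 - 2 * #|I|%:R * s * x i + s ^+ 2)); last first.
    by move=> i _; ring.
  rewrite big_split /= sumrB -!mulr_sumr sumr_const -/s -/q -mulr_natl.
  by ring.
by rewrite pmulr_rge0 ?ltr0n // subr_ge0.
Qed.

(** Here and in [stepsize], [n] counts the visits before the update, hence [n.+1]. *)
Definition bonus beta n : R := beta / Num.sqrt n.+1%:R.

Definition stepsize tau n : R := (1 + 2 * tau) / (n.+1%:R + 2 * tau).

Lemma sqrtS_gt0 n : 0 < Num.sqrt n.+1%:R :> R.
Proof. by rewrite sqrtr_gt0 ltr0n. Qed.

Lemma bonus_le_sqrt beta n : 0 <= beta ->
  bonus beta n <= 2 * beta * (Num.sqrt n.+1%:R - Num.sqrt n%:R).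
Proof.
move=> b0; rewrite /bonus ler_pdivrMr ?sqrtS_gt0 //.
have := sqr_sqrtr (ler0n R n); have := sqr_sqrtr (ler0n R n.+1).
have := sqrtr_ge0 (n%:R : R); have := sqrtS_gt0 n.
move: (Num.sqrt n.+1%:R) (Num.sqrt n%:R) => x y x0 y0 xE yE.
have : 0 <= (x - y) ^+ 2 by exact: sqr_ge0.
have : x ^+ 2 - y ^+ 2 = 1 by rewrite xE yE -natr1; ring.
move=> d s; have : 1 <= 2 * (x - y) * x by lra.
by move=> H; have : beta * 1 <= beta * (2 * (x - y) * x) by [exact: ler_wpM2l]; lra.
Qed.

Lemma stepsize_bound tau n : 0 < tau -> 0 < stepsize tau n <= 1.
Proof.
move=> t0; have n0 : 0 <= n%:R :> R by [].
have d0 : 0 < n.+1%:R + 2 * tau by rewrite -natr1; lra.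
rewrite /stepsize divr_gt0 ?ler_pdivrMr //=; last by lra.
by rewrite -natr1; lra.
Qed.

Lemma stepsize0 tau : 0 < tau -> stepsize tau 0 = 1.
Proof. by move=> t0; rewrite /stepsize divff // lt0r_neq0 //; lra. Qed.

(** An update can lower an entry by at most [stepsize tau n * tau], so the bonus outweighs the drop.
    After squaring it follows from [8 * tau * i <= (i + 2 * tau) ^+ 2] and
    [1 + 2 * tau <= 3 * tau]. *)
Lemma stepsize_tau_le_bonus tau beta l n : 1 <= tau -> 2^-1 <= l -> 0 <= beta ->
  beta ^+ 2 = 16 * tau ^+ 3 * l -> stepsize tau n * tau <= bonus beta n.
Proof.
move=> t1 l1 b0 bE; have t0 : 0 < tau by lra.
have i0 : 0 < n.+1%:R :> R by rewrite ltr0n.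
have d0 : 0 < n.+1%:R + 2 * tau by lra.
rewrite /bonus /stepsize ler_pdivlMr ?sqrtS_gt0 //.
set q := (X in _ * X <= _).
have qE : q ^+ 2 = n.+1%:R by exact: sqr_sqrtr (ltW i0).
have q0 : 0 < q by exact: sqrtS_gt0.
move: q (n.+1%:R : R) i0 d0 qE q0 => q i i0 d0 qE q0.
have -> : (1 + 2 * tau) / (i + 2 * tau) * tau * q = (1 + 2 * tau) * tau * q / (i + 2 * tau) by ring.
rewrite ler_pdivrMr //.
have c0 : 0 < 1 + 2 * tau by lra.
suff : ((1 + 2 * tau) * tau * q) ^+ 2 <= (beta * (i + 2 * tau)) ^+ 2.
  by rewrite ler_pXn2r // nnegrE !mulr_ge0 // ltW.
rewrite !exprMn qE bE.
have : 0 <= (i - 2 * tau) ^+ 2 by exact: sqr_ge0.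
move=> Hs; have H8 : 8 * tau * i <= (i + 2 * tau) ^+ 2 by lra.
have Ht : 0 <= 16 * tau ^+ 3 * l by rewrite -bE sqr_ge0.
have {}H8 := ler_wpM2l Ht H8.
have t4 : 0 <= tau ^+ 4 * i by rewrite mulr_ge0 ?exprn_ge0 ?ltW.
have : (1 + 2 * tau) ^+ 2 <= 9 * tau ^+ 2 by nra.
move=> H9; have : (1 + 2 * tau) ^+ 2 * (tau ^+ 2 * i) <= 9 * tau ^+ 2 * (tau ^+ 2 * i).
  by rewrite ler_wpM2r // mulr_ge0 ?sqr_ge0 // ltW.
have : 0 <= (l - 2^-1) * (tau ^+ 4 * i) by rewrite mulr_ge0 // subr_ge0.
lra.
Qed.

End Scalars.

(** * One Q-learning update *)

Section QStep.
Context (R : realType) (A O S : finType) (a0 : A).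
Context (f : S -> A -> O -> S) (r : S -> A -> O -> R) (tau beta : R).
Implicit Types st : agent_state R A S.

Definition q_target st a o : R :=
  r (cur st) a o + (1 - tau^-1) * max_action a0 (qtab st (f (cur st) a o)).

Definition q_update st a o : R :=
  let n := ntab st (cur st) a in
  Num.min (qtab st (cur st) a + stepsize tau n *
    (q_target st a o - qtab st (cur st) a + bonus beta n)) tau.

(** The effect of [after_action] with the horizon and the bonus scale of the epoch as fixed
    parameters. *)
Definition q_step st a o : agent_state R A S :=
  AgentState (f (cur st) a o)
    (fun x b => if (x == cur st) && (b == a) then q_update st a o else qtab st x b)
    (fun x b => if (x == cur st) && (b == a) then (ntab st (cur st) a).+1
                else ntab st x b).

Lemma qtab_qstep st a o x b : qtab (q_step st a o) x b =
  if (x, b) == (cur st, a) then q_update st a o else qtab st x b.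
Proof. by []. Qed.

Lemma ntab_qstep st a o x b : ntab (q_step st a o) x b =
  if (x, b) == (cur st, a) then (ntab st (cur st) a).+1 else ntab st x b.
Proof. by []. Qed.

Lemma sum_qstep (V : zmodType) (G : S * A -> nat -> R -> V) st a o :
  \sum_p G p (ntab (q_step st a o) p.1 p.2) (qtab (q_step st a o) p.1 p.2) =
  \sum_p G p (ntab st p.1 p.2) (qtab st p.1 p.2) +
    (G (cur st, a) (ntab st (cur st) a).+1 (q_update st a o) -
     G (cur st, a) (ntab st (cur st) a) (qtab st (cur st) a)).
Proof.
rewrite (bigD1 (cur st, a)) //= [X in _ = X + _](bigD1 (cur st, a)) //=.
rewrite !eqxx /= [RHS]addrC addrA subrK; congr (_ + _).
apply: eq_bigr => -[x b] /= /negPf.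
by rewrite xpair_eqE => ->.
Qed.

Definition q_in_range st := forall s a, 0 <= qtab st s a <= tau.

Hypothesis hr : forall s a o, 0 <= r s a o <= 1.
Hypothesis tau1 : 1 <= tau.
Hypothesis beta0 : 0 <= beta.

Let tau_gt0 : 0 < tau. Proof. exact: lt_le_trans tau1. Qed.

Lemma bonus_ge0 n : 0 <= bonus beta n.
Proof. by rewrite /bonus divr_ge0 // sqrtr_ge0. Qed.

Lemma qmax_bound st s : q_in_range st -> 0 <= max_action a0 (qtab st s) <= tau.
Proof. by move=> st_rng; have [a ->] := max_action_ex a0 (qtab st s). Qed.

Lemma target_ge0 st a o : q_in_range st -> 0 <= q_target st a o.
Proof.
move=> st_rng; have /andP[r0 _] := hr (cur st) a o.
have /andP[q0 _] := qmax_bound (f (cur st) a o) st_rng.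
by rewrite addr_ge0 // mulr_ge0 // subr_ge0 invf_le1.
Qed.

Lemma newq_range st a o : q_in_range st -> 0 <= q_update st a o <= tau.
Proof.
move=> st_rng; have y0 := target_ge0 a o st_rng.
rewrite /q_update ge_min lexx orbT andbT le_min (ltW tau_gt0) andbT.
have /andP[q0 _] := st_rng (cur st) a.
set n := ntab _ _ _; have /andP[s0 s1] := stepsize_bound n tau_gt0; have b0 := bonus_ge0 n.
move: (stepsize _ _) (bonus _ _) (q_target _ _ _) (qtab _ _ _) s0 s1 b0 y0 q0 => s b y q.
by move=> *; nra.
Qed.

Lemma qstep_range st a o : q_in_range st -> q_in_range (q_step st a o).
Proof.
move=> st_rng s b; rewrite qtab_qstep; case: ifP => // _.
exact: newq_range.
Qed.

End QStep.

(** * An epoch against an abstract reference table [ref] with values [W] *)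

Section Epoch.
Context (R : realType) (A O S : finType) (a0 : A).
Context (rho : environment R A O) (S0 : S) (f : S -> A -> O -> S)
  (r : S -> A -> O -> R) (hr : forall s a o, 0 <= r s a o <= 1).
Context (tau beta l lam kappa E Delta Wlo Whi : R).
Context (ref : S -> A -> R) (W : history A O -> R).

Local Notation phi := (phi S0 f).
Local Notation gamma := (1 - tau^-1).
Local Notation qstep := (q_step a0 f r tau beta).
Local Notation newq := (q_update a0 f r tau beta).
Local Notation target := (q_target a0 f r tau).
Local Notation qmax := (max_action a0).
Implicit Types (st : agent_state R A S) (h : history A O).

Hypothesis lam01 : 0 <= lam <= 1.
Hypothesis tau4 : 4 <= tau.
Hypothesis beta0 : 0 <= beta.
Hypothesis betaE : beta ^+ 2 = 16 * tau ^+ 3 * l.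
Hypothesis l2 : 2^-1 <= l.
Hypothesis E1 : 1 <= E.
Hypothesis ED : Delta <= E / tau.
Hypothesis ref_le : forall s a, ref s a <= Whi.
Hypothesis W_bound : forall h, Wlo <= W h <= Whi.
Hypothesis W_ref : forall h, exists a, W h <= ref (phi h) a.
Hypothesis ref_Bellman : forall h a, ref (phi h) a - Delta <=
  \sum_o rho h a o * (r (phi h) a o + gamma * W (rcons h (a, o))).
Hypothesis Wlo0 : 0 <= Wlo.
Hypothesis Whi_tau : Whi + (Whi - Wlo) / 20 <= tau.
Hypothesis lam_Wlo : lam * tau - kappa <= Wlo.

Let tau0 : 0 < tau. Proof. by have := tau4; lra. Qed.
Let g0 : 0 < gamma.
Proof. by rewrite subr_gt0 invf_lt1 //; have := tau4; lra. Qed.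
Let g1 : gamma < 1. Proof. by rewrite ltrBlDr ltrDl invr_gt0. Qed.
Let l0 : 0 < l. Proof. by have := l2; lra. Qed.
Let W0 : Wlo <= Whi. Proof. by have /andP[] := W_bound [::]; exact: le_trans. Qed.
Let Whi_le : Whi <= tau.
Proof. by have := Whi_tau; have := W0; lra. Qed.

Let tau1 : 1 <= tau. Proof. by have := tau4; lra. Qed.

Local Notation q_in_range := (q_in_range tau).
Local Notation target_ge0 := (target_ge0 a0 f hr tau1).
Local Notation bonus_ge0 := (bonus_ge0 beta0).
Local Notation qmax_bound := (qmax_bound a0 (tau := tau)).
Local Notation newq_range := (newq_range a0 f hr tau1 beta0).
Local Notation qstep_range := (qstep_range a0 f hr tau1 beta0).

Definition opt st := [forall p : S * A, ref p.1 p.2 - E <= qtab st p.1 p.2].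

(** The constant [c] of the overview. *)
Definition qfloor : R := Num.max (Wlo - E) 0.

(** Invariant, while optimism holds, with [n] of the [L] steps of the epoch left. The floor bounds
    the regret potential from below; the clip clause describes entries whose bonus alone reaches
    [tau]. *)
Record regular (L : nat) h st (n : nat) : Prop := Regular {
  regular_cur : cur st = phi h;
  regular_range : q_in_range st;
  regular_floor : forall s a, (0 < ntab st s a)%N -> qfloor - 1 <= qtab st s a;
  regular_clip : forall s a, (0 < ntab st s a)%N ->
    tau * Num.sqrt (ntab st s a)%:R <= beta -> qtab st s a = tau;
  regular_count : (\sum_(p : S * A) ntab st p.1 p.2 + n)%N = L
}.

Lemma qfloor_ge0 : 0 <= qfloor. Proof. by rewrite le_max lexx orbT. Qed.

Lemma qfloor_le : qfloor <= tau.
Proof.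
rewrite ge_max (ltW tau0) andbT.
by have := E1; have := W0; have := Whi_le; lra.
Qed.

Lemma optP st s a : opt st -> ref s a - E <= qtab st s a.
Proof. by move=> /forallP /(_ (s, a)). Qed.

Lemma qfloor_le_qmax st h : q_in_range st -> opt st -> qfloor <= qmax (qtab st (phi h)).
Proof.
move=> st_rng st_opt; rewrite ge_max; apply/andP; split; last first.
  by apply: le_trans (le_max_action a0 _ a0); case/andP: (st_rng (phi h) a0).
have [a Wa] := W_ref h; apply: le_trans (le_max_action a0 _ a).
apply: le_trans (optP _ _ st_opt).
by have /andP[] := W_bound h; lra.
Qed.

Lemma W_le_qmax st h : opt st -> W h - E <= qmax (qtab st (phi h)).
Proof.
move=> st_opt; have [a Wa] := W_ref h; apply: le_trans (le_max_action a0 _ a).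
by apply: le_trans (optP _ _ st_opt); lra.
Qed.

Let step_bound n : 0 < stepsize tau n <= 1. Proof. exact: stepsize_bound. Qed.

Lemma regular_qstep L h st n a o : regular L h st n.+1 -> opt st ->
  regular L (rcons h (a, o)) (qstep st a o) n.
Proof.
move=> [st_cur st_rng st_fl st_clip st_cnt] st_opt.
have y_fl : qfloor - 1 <= target st a o.
  have q_fl := qfloor_le_qmax (rcons h (a, o)) st_rng st_opt.
  rewrite phi_rcons /= -st_cur in q_fl.
  have /andP[r0 _] := hr (cur st) a o; rewrite /q_target.
  have : gamma * qfloor <= gamma * qmax (qtab st (f (cur st) a o)) by rewrite ler_pM2l.
  (* Discounting the floor costs at most 1, whence [qfloor - 1]. *)
  have : tau^-1 * qfloor <= 1 by rewrite ler_pdivrMl // mulr1 qfloor_le.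
  by lra.
split.
- by rewrite phi_rcons /= st_cur.
- exact: qstep_range.
- move=> s b; rewrite ntab_qstep qtab_qstep; case: ifP => [_ _|_]; last exact: st_fl.
  rewrite /q_update le_min; set n' := ntab _ _ _.
  have -> : qfloor - 1 <= tau by have := qfloor_le; lra.
  rewrite andbT; have b0 := bonus_ge0 n'; have /andP[s0 s1] := step_bound n'.
  have [n0|n0] := posnP n'.
    by rewrite n0 stepsize0 // mul1r; move: (bonus_ge0 0); lra.
  have := st_fl _ _ n0; rewrite -/n'.
  move: (stepsize _ _) (bonus _ _) (target _ _ _) (qtab _ _ _) qfloor s0 s1 b0 y_fl => z b' y q c.
  by move=> *; nra.
- move=> s b; rewrite ntab_qstep qtab_qstep; case: ifP => [_ _|_]; last exact: st_clip.
  set n' := ntab _ _ _ => n'b.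
  have bt : tau <= bonus beta n' by rewrite /bonus ler_pdivlMr ?sqrtS_gt0.
  have y0 := target_ge0 a o st_rng.
  rewrite /q_update -/n'; apply/min_idPr.
  have /andP[s0 s1] := step_bound n'.
  have [n0|n0] := posnP n'.
    by rewrite n0 stepsize0 // mul1r -n0; lra.
  (* An entry at [tau] stays there when the bonus is at least [tau], the target being
     nonnegative. *)
  rewrite (st_clip _ _ n0).
    by move: (stepsize _ _) (bonus _ _) (target _ _ _) s0 s1 bt y0 => z b' y *; nra.
  apply: le_trans n'b; rewrite ler_pM2l // ler_sqrt ?ler_nat //.
- rewrite -st_cnt addnS -addSn; congr (_ + n)%N.
  rewrite (bigD1 (cur st, a)) //= [in RHS](bigD1 (cur st, a)) //= !eqxx /= addSn.
  by congr (_ + _).+1; apply: eq_bigr => -[x b] /= /negPf; rewrite xpair_eqE => ->.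
Qed.

(** * The regret potential *)

(* At its first visit a pair has step size 1 and its initial value is lost; the
   term [- tau] pays for it. *)
Definition entry_pot (n : nat) (q : R) : R :=
  (if n == 0%N then 0 else (n%:R + 2 * tau) / (1 + 2 * tau) * (q - qfloor) - tau)
  - 4 * beta * Num.sqrt n%:R.

(** The weight in [entry_pot] is the inverse of the last step size. Its factor 4 pays for two
    bonuses per step: the one in the update, and the one that covers a drop of the maximum in
    [qmax_qstep]. *)
Definition pot st : R :=
  \sum_(p : S * A) entry_pot (ntab st p.1 p.2) (qtab st p.1 p.2)
  - gamma * (qmax (qtab st (cur st)) - qfloor).

Lemma qmax_qstep st a o s : q_in_range st ->
  qmax (qtab st s) <= qmax (qtab (qstep st a o) s) + bonus beta (ntab st (cur st) a).
Proof.
move=> st_rng; apply: max_action_le => b.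
apply: le_trans (_ : qtab (qstep st a o) s b + bonus beta (ntab st (cur st) a) <= _); last first.
  by rewrite lerD2r; exact: le_max_action.
rewrite qtab_qstep; case: ifP => [/eqP[-> ->]|_]; last by rewrite lerDl bonus_ge0.
rewrite /q_update; set n := ntab _ _ _.
have t1 : 1 <= tau by have := tau4; lra.
have H := stepsize_tau_le_bonus n t1 l2 beta0 betaE.
have b0 := bonus_ge0 n; have /andP[s0 s1] := step_bound n.
have y0 := target_ge0 a o st_rng; have /andP[q0 q1] := st_rng (cur st) a.
rewrite -lerBlDr le_min; apply/andP; split; last by lra.
move: (stepsize _ _) (bonus _ _) (target _ _ _) (qtab _ _ _) s0 s1 b0 H y0 q0 q1 => z b' y q.
move=> s0 s1 b0 H y0 q0 q1.
have : z * q <= z * tau by rewrite ler_pM2l.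
have : 0 <= z * y by rewrite mulr_ge0 // ltW.
have : 0 <= z * b' by rewrite mulr_ge0 // ltW.
by lra.
Qed.

(** Multiplied by the inverse step size, the update adds [y - q]; the weight itself grows by
    [1 / (1 + 2 * tau)], which is at most [1 / tau]. *)
Lemma entry_pot_incr n (q q' y : R) : qfloor <= q <= tau ->
  q' <= q + stepsize tau n * (y - q) ->
  entry_pot n.+1 q' - entry_pot n q
    + 4 * beta * (Num.sqrt n.+1%:R - Num.sqrt n%:R)
  <= y - qfloor - gamma * (q - qfloor).
Proof.
move=> /andP[q0 q1] q'E; rewrite /entry_pot /=.
have d0 : 0 < 1 + 2 * tau by have := tau0; lra.
have z0 : 0 <= q - qfloor by lra.
suff : (n.+1%:R + 2 * tau) / (1 + 2 * tau) * (q' - qfloor) - tau -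
  (if n == 0%N then 0 else (n%:R + 2 * tau) / (1 + 2 * tau) * (q - qfloor) - tau)
  <= y - qfloor - gamma * (q - qfloor).
  move: (if n == 0%N then _ else _) (_ / _ * (q' - qfloor)) (gamma * _) => u v w.
  move: (Num.sqrt _) (Num.sqrt _) => s1 s2.
  by lra.
have fl0 := qfloor_ge0.
(* At the first visit the term [- tau] absorbs [gamma * (q - qfloor)]. *)
case: n q'E => [|n] /= q'E.
  rewrite stepsize0 // mul1r in q'E; rewrite divff ?lt0r_neq0 // mul1r.
  have : gamma * (q - qfloor) <= q - qfloor by rewrite ler_piMl // ltW.
  by lra.
have i0 : 0 < n.+2%:R + 2 * tau by rewrite ltr_wpDl // mulr_gt0.
have {q'E} : (n.+2%:R + 2 * tau) * q' <= (n.+2%:R + 2 * tau) * q + (1 + 2 * tau) * (y - q).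
  have := q'E; rewrite -(ler_pM2l i0) => /le_trans; apply.
  by rewrite mulrDr lerD2l /stepsize mulrA mulrCA mulfV ?mulr1 ?lt0r_neq0.
have -> : n.+2%:R = n.+1%:R + 1 :> R by rewrite natr1.
move: (n.+1%:R : R) => i q'E.
rewrite opprB addrA subrK.
rewrite -[_ / _ * (q' - _)]mulrAC -[_ / _ * (q - _)]mulrAC -mulrBl ler_pdivrMr //.
have : tau^-1 * (q - qfloor) * (1 + 2 * tau) >= q - qfloor.
  rewrite -[leLHS]mul1r mulrAC ler_wpM2r // mulrDr mulrCA mulVf ?lt0r_neq0 // mulr1.
  have : 0 < tau^-1 by rewrite invr_gt0.
  by lra.
by lra.
Qed.

(** Since the action is greedy, [gamma * (q - qfloor)] is the maximum term of the old potential, and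
    the target contains that of the new one. What remains is the reward minus [qfloor / tau], which
    is at least [lam - (kappa + E) / tau]. *)
Lemma regret_le_pot L h st n a o : regular L h st n -> opt st ->
  qmax (qtab st (cur st)) = qtab st (cur st) a ->
  lam - r (phi h) a o <= (kappa + E) / tau + pot st - pot (qstep st a o).
Proof.
move=> [st_cur st_rng st_fl st_clip st_cnt] st_opt st_max.
rewrite -st_cur /pot (sum_qstep a0 f r tau beta (fun _ => entry_pot)) /= /entry_pot.
set N := ntab _ _ _; set q := qtab st (cur st) a; set q' := newq _ _ _.
have bS := @bonus_le_sqrt R beta N beta0; have b0 := bonus_ge0 N.
have fl_q : qfloor <= q by rewrite /q -st_max st_cur; exact: qfloor_le_qmax.
have /andP[_ q_tau] := st_rng (cur st) a; rewrite -/q in q_tau.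
have q'E : q' <= q + stepsize tau N * (target st a o + bonus beta N - q).
  by rewrite /q' /q_update ge_min -/N -/q addrAC lexx.
have := entry_pot_incr _ q'E; rewrite fl_q q_tau /entry_pot => /(_ isT).
have := qmax_qstep a o (f (cur st) a o) st_rng; rewrite -/N.
rewrite st_max -/q.
set x' := qmax (qtab st _); set x2 := qmax (qtab (qstep st a o) _).
change (max_action a0 (fun b : A => if (f (cur st) a o == cur st) && (b == a)
  then q' else qtab st (f (cur st) a o) b)) with x2.
rewrite /q_target -/x' /=.
set P1 := (if N == 0%N then _ else _); set P2 := _ / _ * (q' - qfloor).
move: (Num.sqrt N%:R) (Num.sqrt N.+1%:R) bS => s1 s2 bS.
move: (\sum_p _) P1 P2 => Sg P1 P2 x'le HE.
have fl : lam - (kappa + E) / tau <= tau^-1 * qfloor.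
  have -> : lam - (kappa + E) / tau = tau^-1 * (lam * tau - kappa - E).
    by field; exact: lt0r_neq0.
  rewrite ler_pM2l ?invr_gt0 //.
  apply: (@le_trans _ _ (Wlo - E)); first by have := lam_Wlo; lra.
  by rewrite le_max lexx.
have : gamma * x' <= gamma * (x2 + bonus beta N) by rewrite ler_pM2l.
have : gamma * bonus beta N <= bonus beta N by rewrite ler_piMl // ltW.
move: fl bS HE; move: (r _ _ _) (bonus _ _) (tau^-1) => r' b' t.
lra.
Qed.

Definition pot_range (L : nat) : R :=
  L%:R / (1 + 2 * tau) + #|{: S * A}|%:R * (1 + tau)
  + 4 * beta * Num.sqrt (#|{: S * A}|%:R * L%:R) + tau.

(** By the floor, a visited entry loses at most its weight, and [tau] for its first visit. The
    counts add up to at most [L], so Cauchy-Schwarz bounds the sum of their square roots. *)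
Lemma pot_ge L h st n : regular L h st n -> - pot_range L <= pot st.
Proof.
move=> [st_cur st_rng st_fl st_clip st_cnt].
have d0 : 0 < 1 + 2 * tau by have := tau0; lra.
have NL : \sum_(p : S * A) (ntab st p.1 p.2)%:R <= L%:R :> R.
  by rewrite -natr_sum ler_nat -st_cnt leq_addr.
have zle : gamma * (qmax (qtab st (cur st)) - qfloor) <= tau.
  have /andP[x0 x1] := qmax_bound (cur st) st_rng.
  have fl0 := qfloor_ge0; have g0' := g0; have g1' := g1.
  have : gamma * (qmax (qtab st (cur st)) - qfloor) <= gamma * tau.
    by rewrite ler_pM2l //; lra.
  by move/le_trans; apply; rewrite ler_piMl // ltW.
have sq : \sum_(p : S * A) Num.sqrt (ntab st p.1 p.2)%:R <=
    Num.sqrt (#|{: S * A}|%:R * L%:R) :> R.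
  have s0 : 0 <= \sum_(p : S * A) Num.sqrt (ntab st p.1 p.2)%:R :> R.
    by apply: sumr_ge0 => p _; exact: sqrtr_ge0.
  rewrite -(ger0_norm s0).
  rewrite -sqrtr_sqr ler_sqrt ?mulr_ge0 //; apply: le_trans (sqr_sum_le _) _.
  rewrite ler_wpM2l //; apply: le_trans NL.
  by apply: ler_sum => p _; rewrite sqr_sqrtr.
have low (p : S * A) : - ((ntab st p.1 p.2)%:R / (1 + 2 * tau)) - (1 + tau)
    - 4 * beta * Num.sqrt (ntab st p.1 p.2)%:R
    <= entry_pot (ntab st p.1 p.2) (qtab st p.1 p.2).
  rewrite /entry_pot lerD2r; have [->|n0] := posnP (ntab st p.1 p.2).
    by rewrite /= mul0r; have := tau0; lra.
  have -> : - ((ntab st p.1 p.2)%:R / (1 + 2 * tau)) - (1 + tau) =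
      - (((ntab st p.1 p.2)%:R + (1 + 2 * tau)) / (1 + 2 * tau)) - tau.
    by field; exact: lt0r_neq0.
  rewrite lerD2r.
  have k0 : 0 <= ((ntab st p.1 p.2)%:R + 2 * tau) / (1 + 2 * tau).
    by apply: divr_ge0; [rewrite addr_ge0 // mulr_ge0 // ltW | exact: ltW].
  have k1 : ((ntab st p.1 p.2)%:R + 2 * tau) / (1 + 2 * tau) <=
     ((ntab st p.1 p.2)%:R + (1 + 2 * tau)) / (1 + 2 * tau).
    by rewrite ler_pM2r ?invr_gt0 //; lra.
  have := st_fl _ _ n0; move: k0 k1.
  move: (_ / _) (_ / _) (qtab _ _ _) => k' k q k0 k1 ql.
  have : k * (-1) <= k * (q - qfloor) by rewrite ler_wpM2l //; lra.
  by lra.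
rewrite /pot.
apply: le_trans (lerB (ler_sum _ (fun p _ => low p)) zle).
rewrite !sumrB -mulr_sumr sumrN -mulr_suml sumr_const -[(1 + tau) *+ _]mulr_natl /pot_range.
have : 4 * beta * \sum_(p : S * A) Num.sqrt (ntab st p.1 p.2)%:R <=
   4 * beta * Num.sqrt (#|{: S * A}|%:R * L%:R).
  by rewrite ler_wpM2l // mulr_ge0.
have : (\sum_(p : S * A) (ntab st p.1 p.2)%:R) / (1 + 2 * tau) <= L%:R / (1 + 2 * tau) :> R.
  by rewrite ler_pM2r // invr_gt0.
move: (\sum_p _) (\sum_p _) => x y.
lra.
Qed.


(** * The failure potential *)

Let nu : R := 1 + (Whi - Wlo).

(** The rate [K] of the overview, chosen so that the variance term of Hoeffding's lemma uses at most
    half of the bonus. *)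
Definition conf_rate : R := 4 * beta / (nu ^+ 2 * (1 + 2 * tau)).

(* When [tau * sqrt n <= beta] the bonus alone truncates the entry at [tau]. *)
Definition conf_pot (p : S * A) (n : nat) (q : R) : R :=
  if beta < tau * Num.sqrt n%:R then
    expR (conf_rate * Num.sqrt n%:R * (ref p.1 p.2 - E - q)) else 0.

Definition fail_pot st : R :=
  \sum_(p : S * A) conf_pot p (ntab st p.1 p.2) (qtab st p.1 p.2).

Let nu1 : 1 <= nu. Proof. by rewrite /nu; have := W0; lra. Qed.

Let nu_le : nu <= 1 + tau.
Proof. by rewrite /nu; have := Wlo0; have := Whi_le; lra. Qed.

Let den_gt0 : 0 < nu ^+ 2 * (1 + 2 * tau).
Proof. by have := nu1; have := tau0; move=> *; rewrite mulr_gt0 ?exprn_gt0 //; lra. Qed.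

Lemma conf_rate_ge0 : 0 <= conf_rate.
Proof. by apply: divr_ge0; [rewrite mulr_ge0 | exact: ltW]. Qed.

Lemma conf_pot_ge0 p n q : 0 <= conf_pot p n q.
Proof. by rewrite /conf_pot; case: ifP => // _; exact: expR_ge0. Qed.

Lemma fail_pot_ge0 st : 0 <= fail_pot st.
Proof. by apply: sumr_ge0 => p _; exact: conf_pot_ge0. Qed.

Lemma margin s a : nu / 20 <= tau - (ref s a - E).
Proof.
by have := ref_le s a; have := Whi_tau; have := E1; rewrite /nu; lra.
Qed.

(** The half of the bonus left by the variance term yields the exponent [- l]. *)
Lemma conf_rate_bonus : l <= conf_rate * beta / 2.
Proof.
have nu0 : 0 < nu by have := nu1; lra.
have d0 : 0 < 1 + 2 * tau by have := tau0; lra.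
have -> : conf_rate * beta / 2 = 2 * beta ^+ 2 / (nu ^+ 2 * (1 + 2 * tau)).
  by rewrite /conf_rate; field; rewrite !lt0r_neq0.
rewrite betaE ler_pdivlMr //.
have -> : 2 * (16 * tau ^+ 3 * l) = l * (32 * tau ^+ 3) by ring.
rewrite ler_pM2l //; have t4 := tau4.
(* From [4 <= tau] one has [1 + tau <= 5 / 4 * tau] and [1 + 2 * tau <= 9 / 4 * tau]. *)
have n2 : nu ^+ 2 <= (5 / 4 * tau) ^+ 2.
  by rewrite ler_pXn2r // ?nnegrE; have := nu1; have := nu_le; lra.
have : nu ^+ 2 * (1 + 2 * tau) <= (5 / 4 * tau) ^+ 2 * (9 / 4 * tau).
  by apply: ler_pM; [exact: sqr_ge0 | lra | exact: n2 | lra].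
have : 0 <= tau ^+ 3 by rewrite exprn_ge0 // ltW.
by lra.
Qed.

(** Makes a truncated entry harmless: its term in the failure potential is at most [expR (- l)]. *)
Lemma conf_rate_margin (x : R) s a : beta < tau * x -> 
  l <= conf_rate * x * (tau - (ref s a - E)).
Proof.
move=> bx; have x0 : 0 < x by rewrite -(pmulr_rgt0 _ tau0); exact: le_lt_trans bx.
have m0 : 0 < nu / 20 by rewrite divr_gt0 //; have := nu1; lra.
apply: (@le_trans _ _ (conf_rate * (beta / tau) * (nu / 20))); last first.
  apply: ler_pM; last exact: margin.
  - by rewrite mulr_ge0 ?conf_rate_ge0 // divr_ge0 // ltW.
  - exact: ltW.
  - by rewrite ler_wpM2l ?conf_rate_ge0 // ler_pdivrMr // mulrC ltW.
have nu0 : 0 < nu by have := nu1; lra.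
have d0 : 0 < 1 + 2 * tau by have := tau0; lra.
have -> : conf_rate * (beta / tau) * (nu / 20) =
    l * (16 * tau ^+ 2 * 4 / (20 * nu * (1 + 2 * tau))).
  have -> : conf_rate * (beta / tau) * (nu / 20) =
     beta ^+ 2 * (4 / (20 * nu * (1 + 2 * tau) * tau)).
    by rewrite /conf_rate; field; rewrite !lt0r_neq0.
  by rewrite betaE; field; rewrite !lt0r_neq0.
rewrite -[leLHS]mulr1 ler_pM2l // ler_pdivlMr ?mulr_gt0 // mul1r.
have t4 := tau4.
have : nu * (1 + 2 * tau) <= (1 + tau) * (1 + 2 * tau) by rewrite ler_pM2r.
nra.
Qed.

Lemma expR_mix (t x y : R) : 0 <= t <= 1 ->
  expR ((1 - t) * x + t * y) <= expR x + expR y.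
Proof.
move=> /andP[t0 t1].
have [xy|/ltW yx] := leP x y.
  apply: (@le_trans _ _ (expR y)); last by rewrite lerDr expR_ge0.
  rewrite ler_expR; nra.
apply: (@le_trans _ _ (expR x)); last by rewrite lerDl expR_ge0.
rewrite ler_expR; nra.
Qed.

(** The supermartingale step. One [expR (- l)] pays for truncation; the other comes from [expR_mix],
    or from a term that becomes active at this update. *)
Lemma fail_pot_step L h st n a : regular L h st n -> opt st ->
  \sum_o rho h a o * fail_pot (qstep st a o) <= fail_pot st + 2 * expR (- l).
Proof.
move=> [st_cur st_rng st_fl st_clip st_cnt] st_opt.
pose N := ntab st (cur st) a; pose q := qtab st (cur st) a.
pose R0 := ref (cur st) a - E.
have e0 := expR_ge0 (- l).
suff key : \sum_o rho h a o * conf_pot (cur st, a) N.+1 (newq st a o) <=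
    conf_pot (cur st, a) N q + 2 * expR (- l).
  rewrite /fail_pot.
  under eq_bigr => o _ do rewrite (sum_qstep a0 f r tau beta conf_pot) -/N -/q.
  have -> : \sum_o rho h a o * (\sum_(p : S * A) conf_pot p (ntab st p.1 p.2) (qtab st p.1 p.2) +
      (conf_pot (cur st, a) N.+1 (newq st a o) - conf_pot (cur st, a) N q)) =
    \sum_(p : S * A) conf_pot p (ntab st p.1 p.2) (qtab st p.1 p.2) +
     (\sum_o rho h a o * conf_pot (cur st, a) N.+1 (newq st a o) - conf_pot (cur st, a) N q).
    set X := \sum_(p : S * A) _; set q0 := conf_pot _ N q.
    under eq_bigr => o _ do rewrite mulrDr mulrBr.
    by rewrite big_split /= sumrB !fdist_mean_cst.
  by rewrite lerD2l lerBlDl.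
have [act|act] := boolP (beta < tau * Num.sqrt N.+1%:R); last first.
  rewrite big1 => [|o _]; last by rewrite /conf_pot (negPf act) mulr0.
  by rewrite addr_ge0 ?conf_pot_ge0 // mulr_ge0.
under eq_bigr => o _ do rewrite /conf_pot act /= -/R0.
rewrite /conf_pot /= -/R0.
set th := conf_rate * Num.sqrt N.+1%:R.
have sS0 := @sqrtS_gt0 R N.
have th0 : 0 <= th by rewrite mulr_ge0 ?conf_rate_ge0 // ltW.
have /andP[al0 al1] := step_bound N; set al := stepsize tau N in al0 al1.
have u0 : R0 - q <= 0 by rewrite subr_le0; exact: optP.
pose X o := r (phi h) a o + gamma * W (rcons h (a, o)).
(* Optimism at the next state bounds the target from below by the reference. *)
have tgt o : X o - gamma * E <= target st a o.
  have := W_le_qmax (rcons h (a, o)) st_opt; rewrite phi_rcons /= -st_cur => H.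
  rewrite /X /q_target -st_cur -addrA -mulrBr lerD2l ler_wpM2l //; exact: ltW.
have marg : l <= th * (tau - R0) by exact: conf_rate_margin.
(* Without truncation the exponent is affine in the target; a truncated entry has exponent at most
   [- l] by the margin. *)
have split_exp o : expR (th * (R0 - newq st a o)) <=
    expR (th * (1 - al) * (R0 - q) - th * al * (bonus beta N - gamma * E - R0)) *
     expR (- (th * al * X o)) + expR (- l).
  have b0 := bonus_ge0 N.
  rewrite -expRD /q_update -/N -/q -/al minEle; case: ifP => _.
    rewrite -[leLHS]addr0; apply: lerD; last exact: e0.
    rewrite ler_expR.
    have H : th * al * (X o - gamma * E) <= th * al * target st a o.
      by rewrite ler_wpM2l // mulr_ge0 // ltW.
    by move: H; move: (target _ _ _) (X o) (bonus _ _) (gamma) => y x b g; lra.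
  rewrite -[leLHS]add0r; apply: lerD; first exact: expR_ge0.
  by rewrite ler_expR; lra.
apply: le_trans (fdist_mean_le _ split_exp) _.
under eq_bigr => o _ do rewrite mulrDr.
rewrite big_split /= -mulr_suml pmf_sum1 mul1r.
under eq_bigr => o _ do rewrite mulrCA.
rewrite -mulr_sumr.
have Xb o : gamma * Wlo <= X o <= gamma * Wlo + nu.
  have /andP[r0 r1] := hr (phi h) a o; have /andP[w0 w1] := W_bound (rcons h (a, o)).
  have g1' := g1; have W0' := W0.
  have : gamma * Wlo <= gamma * W (rcons h (a, o)) by rewrite ler_pM2l.
  have : gamma * (W (rcons h (a, o)) - Wlo) <= 1 * (W (rcons h (a, o)) - Wlo).
    by rewrite ler_wpM2r ?subr_ge0 // ltW.
  by rewrite /X /nu; lra.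
have nu0 : 0 < nu by have := nu1; lra.
have tal0 : 0 <= th * al by rewrite mulr_ge0 // ltW.
have Hoef := hoeffding_lower nu0 Xb tal0 (ref_Bellman h a).
apply: (@le_trans _ _ (expR ((1 - al) * (th * (R0 - q)) + al * (- l)) + expR (- l))).
  rewrite lerD2r; apply: le_trans (ler_wpM2l (expR_ge0 _) Hoef) _.
  rewrite -expRD ler_expR.
  have var : (th * al * nu) ^+ 2 / 8 <= th * al * bonus beta N / 2.
    have : th * al * nu ^+ 2 <= 4 * bonus beta N.
      rewrite /bonus /th /conf_rate /al /stepsize.
      set sq := Num.sqrt _.
      have sqE : sq ^+ 2 = N.+1%:R by exact: sqr_sqrtr (ler0n R _).
      have sq0 : 0 < sq by exact: sS0.
      rewrite -sqE; move: sq sq0 {sqE} => sq sq0.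
      pose i := sq ^+ 2; have i0 : 0 < i by rewrite exprn_gt0.
      rewrite -/i.
      have t0 := tau0; have d0 : 0 < 1 + 2 * tau by lra.
      have d1 : 0 < i + 2 * tau by lra.
      have -> : 4 * beta / (nu ^+ 2 * (1 + 2 * tau)) * sq * ((1 + 2 * tau) / (i + 2 * tau)) * nu ^+ 2
         = 4 * (beta * (sq / (i + 2 * tau))).
        by field; rewrite !lt0r_neq0.
      rewrite ler_pM2l // ler_wpM2l // ler_pdivrMr // ler_pdivlMl // -expr2 -/i.
      by lra.
    move/(ler_wpM2l tal0).
    by rewrite exprMn; move: (th * al) (nu) (bonus _ _) => x y z; nra.
  have bl : al * l <= th * al * bonus beta N / 2.
    have -> : th * al * bonus beta N / 2 = al * (conf_rate * beta / 2).
      by rewrite /th /bonus; field; exact: lt0r_neq0.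
    by rewrite ler_pM2l //; exact: conf_rate_bonus.
  (* The slack [E] is subtracted undiscounted on one side and discounted in the target: the
     difference [E / tau] covers the distortion. *)
  have EDg : 0 <= th * al * (E / tau - Delta) by rewrite mulr_ge0 // subr_ge0.
  have R0E : ref (phi h) a = R0 + E by rewrite /R0 st_cur subrK.
  rewrite R0E.
  move: var bl EDg; move: (bonus _ _) ((_ * nu) ^+ 2 / 8) => b v.
  by move: (tau^-1) => ti; lra.
have al01 : 0 <= al <= 1 by rewrite al1 ltW.
case: ifP => actN.
  have N0 : (0 < N)%N.
    rewrite lt0n; apply/eqP => N0; move: actN; rewrite N0 sqrtr0 mulr0 ltNge.
    by rewrite beta0.
  (* Under optimism [R0 - q] is nonpositive, so the larger rate after the visit only lowers the
     exponent. *)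
  have mono : th * (R0 - q) <= conf_rate * Num.sqrt N%:R * (R0 - q).
    rewrite ler_wnM2r // /th ler_wpM2l ?conf_rate_ge0 //.
    by rewrite ler_sqrt ?ler_nat.
  apply: (@le_trans _ _ (expR (conf_rate * Num.sqrt N%:R * (R0 - q)) + expR (- l) + expR (- l))).
    rewrite lerD2r; apply: le_trans (expR_mix _ _ al01).
    rewrite ler_expR lerD2r ler_wpM2l // subr_ge0 //.
  by rewrite -addrA lerD2l; lra.
rewrite add0r [leRHS]mulrDl mul1r lerD2r ler_expR.
(* The term was inactive before: either the step size is 1 and the old value disappears, or the old
   value is [tau]. *)
have [N0|N0] := posnP N.
  by rewrite /al N0 stepsize0 // subrr mul0r add0r mul1r.
have qE : q = tau by apply: st_clip => //; rewrite leNgt -/N actN.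
have : (1 - al) * (th * (R0 - q)) <= (1 - al) * (- l).
  by rewrite ler_wpM2l ?subr_ge0 // qE; lra.
by lra.
Qed.

(** Only the updated entry can fail. Its term is active, for otherwise clipping would put it at
    [tau], above the reference; then its exponent is nonnegative. *)
Lemma fail_pot_ge1 L h st n a o : regular L h st n.+1 -> opt st ->
  ~~ opt (qstep st a o) -> 1 <= fail_pot (qstep st a o).
Proof.
move=> reg st_opt.
rewrite negb_forall => /existsP[[s b]] /=; rewrite -ltNge => Hlt.
rewrite /fail_pot (bigD1 (s, b)) //=.
rewrite -[leLHS]addr0; apply: lerD; last by apply: sumr_ge0 => p _; exact: conf_pot_ge0.
have E_p : (s, b) = (cur st, a).
  apply/eqP; apply: contraTT Hlt; rewrite xpair_eqE /= => /negPf ->.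
  by rewrite -leNgt; exact: optP.
rewrite /conf_pot; case: ifP => act.
  rewrite -expR0 ler_expR mulr_ge0 ?subr_ge0 ?(ltW Hlt) //.
  by rewrite mulr_ge0 ?conf_rate_ge0 // sqrtr_ge0.
have [_ _ _ clip' _] := regular_qstep a o reg st_opt.
have : qtab (qstep st a o) s b < ref s b - E by exact: Hlt.
rewrite clip' ?leNgt ?act //.
  by have := margin s b; have := nu1; lra.
by rewrite ntab_qstep E_p eqxx.
Qed.


(** Expected regret inside one epoch; the continuation [K] stands for the later epochs, which see
    the final agent state. *)
Fixpoint regret_rec (n : nat) h st (K : history A O -> agent_state R A S -> R) : R :=
  if n is n'.+1 then
    \sum_a unif R (greedy_gt0 a0 (qtab st (cur st))) a * \sum_o rho h a o *
      (lam - r (phi h) a o + regret_rec n' (rcons h (a, o)) (qstep st a o) K)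
  else K h st.

Lemma unif_greedy_mean_le (q F : A -> R) (c : R) :
  (forall a, qmax q = q a -> F a <= c) ->
  \sum_a unif R (greedy_gt0 a0 q) a * F a <= c.
Proof.
move=> Fc; rewrite -[leRHS](fdist_mean_cst (unif R (greedy_gt0 a0 q))).
apply: ler_sum => a _; rewrite /= /unif_pmf; case: ifP => [|_]; last by rewrite !mul0r.
by rewrite inE => /eqP qa; rewrite ler_wpM2l ?invr_ge0 // Fc.
Qed.

Lemma regret_rec_trivial (M : nat) K (B : R) n h st :
  (forall h st, cur st = phi h -> q_in_range st -> size h = M -> K h st <= B) ->
  cur st = phi h -> q_in_range st -> (size h + n)%N = M ->
  regret_rec n h st K <= n%:R + B.
Proof.
move=> KB; elim: n h st => [|n IH] h st st_cur st_rng hM /=.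
  by rewrite add0r KB // -hM addn0.
apply: unif_greedy_mean_le => a _; rewrite -[leRHS](fdist_mean_cst (rho h a)).
apply: fdist_mean_le => o; have /andP[r0 _] := hr (phi h) a o.
have /andP[_ l1] := lam01.
have := IH (rcons h (a, o)) (qstep st a o).
rewrite phi_rcons /= st_cur size_rcons addSnnS => /(_ erefl (qstep_range _ _ st_rng) hM).
by rewrite -natr1; lra.
Qed.

Hypothesis kappa0 : 0 <= kappa.

(** * Regret of an epoch followed by a continuation *)

Section Continuation.
Context (L M : nat) (K : history A O -> agent_state R A S -> R) (B b : R).
Hypothesis b0 : 0 <= b.
Hypothesis K_range : forall h st, cur st = phi h -> q_in_range st ->
  size h = M -> K h st <= B + b * tau.
Hypothesis K_opt : forall h st, cur st = phi h -> q_in_range st -> opt st ->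
  size h = M -> K h st <= B.

(** Backward induction. Failure costs at most [F], which covers the remaining steps and the
    surcharge [b * tau] of the continuation; it is charged to [fail_pot], as in a maximal inequality
    with a stopping time. *)
Lemma regret_rec_le n h st : regular L h st n -> opt st -> (size h + n)%N = M ->
  regret_rec n h st K <= n%:R * ((kappa + E) / tau) + pot st + pot_range L + B
    + (L%:R + b * tau) * (fail_pot st + 2 * n%:R * expR (- l)).
Proof.
set F := L%:R + b * tau.
have F0 : 0 <= F by rewrite addr_ge0 // mulr_ge0 // ltW.
have e0 := expR_ge0 (- l).
have KE0 : 0 <= (kappa + E) / tau.
  by apply: divr_ge0; [have := E1; have := kappa0; lra | exact: ltW].
elim: n h st => [|n IH] h st reg st_opt hM.
  have [st_cur st_rng _ _ _] := reg; have pg := pot_ge reg.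
  have := K_opt st_cur st_rng st_opt; rewrite -hM addn0 => /(_ erefl) /= KB.
  have : 0 <= F * (fail_pot st + 2 * 0%:R * expR (- l)).
    by rewrite mulr0 mul0r addr0 mulr_ge0 // fail_pot_ge0.
  by rewrite mul0r; lra.
rewrite /=; apply: unif_greedy_mean_le => a a_max.
pose C := n.+1%:R * ((kappa + E) / tau) + pot st + pot_range L + B + F * (2 * n%:R * expR (- l)).
apply: (@le_trans _ _ (\sum_o rho h a o * (C + F * fail_pot (qstep st a o)))); last first.
  under eq_bigr => o _ do rewrite mulrDr [rho _ _ _ * (F * _)]mulrCA.
  rewrite big_split /= fdist_mean_cst -mulr_sumr.
  have := ler_wpM2l F0 (fail_pot_step a reg st_opt).
  by rewrite /C -[n.+1%:R]natr1; lra.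
apply: fdist_mean_le => o.
have step := regret_le_pot o reg st_opt a_max.
have reg' := regular_qstep a o reg st_opt.
have hM' : (size (rcons h (a, o)) + n)%N = M by rewrite size_rcons addSnnS.
have KEn : 0 <= n%:R * ((kappa + E) / tau) by rewrite mulr_ge0.
have [st'_opt|st'_nopt] := boolP (opt (qstep st a o)).
  by have := IH _ _ reg' st'_opt hM'; rewrite /C -[n.+1%:R]natr1; lra.
(* Optimism is lost here: the trivial bound applies and [fail_pot_ge1] pays for it. *)
have [cur' rng' _ _ cnt'] := reg'.
have triv := regret_rec_trivial K_range cur' rng' hM'.
have nL : n%:R <= L%:R :> R by rewrite ler_nat -cnt' leq_addl.
have pg := pot_ge reg'.
have : F * 1 <= F * fail_pot (qstep st a o).
  by rewrite ler_wpM2l // (fail_pot_ge1 reg).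
have : 0 <= F * (2 * n%:R * expR (- l)) by rewrite !mulr_ge0.
have : n%:R + b * tau <= F by rewrite /F lerD2r.
by rewrite /C -[n.+1%:R]natr1; lra.
Qed.

Lemma epoch_regret_le h st : cur st = phi h -> q_in_range st -> opt st ->
  (forall s a, ntab st s a = 0%N) -> (size h + L)%N = M ->
  regret_rec L h st K <= L%:R * ((kappa + E) / tau) + pot_range L + B
    + (L%:R + b * tau) * (2 * L%:R * expR (- l)).
Proof.
move=> st_cur st_rng st_opt st_n hM.
have reg : regular L h st L.
  split => // [s a|s a|]; rewrite ?st_n //.
  by rewrite big1 // => p _; rewrite st_n.
have := regret_rec_le reg st_opt hM.
have -> : fail_pot st = 0.
  rewrite /fail_pot big1 // => p _; rewrite /conf_pot st_n sqrtr0 mulr0.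
  by rewrite ltNge beta0.
have : pot st <= 0.
  rewrite /pot big1 => [|p _]; last by rewrite /entry_pot st_n /= sqrtr0 mulr0 subr0.
  rewrite sub0r oppr_le0; apply: mulr_ge0; first exact: ltW.
  by rewrite subr_ge0 st_cur; exact: qfloor_le_qmax.
by rewrite add0r; lra.
Qed.

End Continuation.

End Epoch.

(** * The schedule and the run of the agent *)

Section Schedule.
Context (R : realType).
Local Notation cp := change_point.

Lemma change_point_gt0 k : (0 < cp k)%N.
Proof. by case: k => // k; rewrite /= muln_gt0 expn_gt0. Qed.

Lemma change_pointS k : cp k.+2 = (2 * cp k.+1)%N.
Proof. by rewrite /= expnS mulnCA. Qed.

(** An equality except for the first change, from 1 to 20. *)
Lemma change_point_double k : (2 * cp k <= cp k.+1)%N.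
Proof. by case: k => // k; rewrite change_pointS. Qed.

Lemma ltn_change_point k : (cp k < cp k.+1)%N.
Proof.
apply: leq_trans (change_point_double k).
by rewrite mul2n -addnn -[X in (X < _)%N]addn0 ltn_add2l change_point_gt0.
Qed.

Lemma leq_change_point i j : (i <= j)%N -> (cp i <= cp j)%N.
Proof.
by apply: (homo_leq (r := leq)) => // [? ? ?|k]; [exact: leq_trans | exact/ltnW/ltn_change_point].
Qed.

Lemma change_point_ge k : (k < cp k)%N.
Proof. by elim: k => // k IH; apply: leq_ltn_trans (ltn_change_point k). Qed.

Lemma epoch_eq k t : (cp k <= t < cp k.+1)%N -> epoch t = k.
Proof.
move=> /andP[kt tk]; apply/eqP; rewrite eqn_leq; apply/andP; split.
  apply/bigmax_leqP => j jt; rewrite leqNgt; apply/negP => kj.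
  by have := leq_trans tk (leq_trans (leq_change_point kj) jt); rewrite ltnn.
have kt1 : (k < t.+1)%N by rewrite ltnS (leq_trans (ltnW (change_point_ge k))).
exact: (leq_bigmax_cond (Ordinal kt1)).
Qed.

Lemma epochP t : (0 < t)%N -> (cp (epoch t) <= t < cp (epoch t).+1)%N.
Proof.
move=> t0.
have ex : exists k, (cp k <= t)%N by exists 0%N.
have ub k : (cp k <= t)%N -> (k <= t)%N by apply: leq_trans; exact/ltnW/change_point_ge.
have [k kt kmax] := ex_maxnP ex ub.
have kt' : (cp k <= t < cp k.+1)%N.
  by rewrite kt ltnNge; apply/negP => /kmax; rewrite ltnn.
by rewrite (epoch_eq kt').
Qed.

Lemma epoch0 : epoch 0 = 0%N.
Proof.
apply/eqP; rewrite -leqn0; apply/bigmax_leqP => j.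
by rewrite leqn0 eqn0Ngt change_point_gt0.
Qed.

Lemma epoch_lt_change_point t : (t < cp (epoch t).+1)%N.
Proof. by case: t => [|t]; [rewrite epoch0 | have /andP[] := epochP (ltn0Sn t)]. Qed.

Lemma leq_epoch t : (epoch t <= epoch t.+1)%N.
Proof.
case: t => [|t]; first by rewrite epoch0.
have /andP[le_t _] := epochP (ltn0Sn t).
have /andP[_ t_lt] := epochP (ltn0Sn t.+1).
rewrite leqNgt; apply/negP => /leq_change_point H.
by have := leq_trans t_lt (leq_trans H le_t); rewrite ltnNge leqnSn.
Qed.

Definition horizon (k : nat) : R := (cp k)%:R `^ (1 / 5).

Lemma tau_atE t : tau_at R t = horizon (epoch t). Proof. by []. Qed.

Lemma horizon_gt0 k : 0 < horizon k.
Proof. by rewrite powR_gt0 // ltr0n change_point_gt0. Qed.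

Lemma horizonX5 k : horizon k ^+ 5 = (cp k)%:R.
Proof.
rewrite /horizon -powR_mulrn ?powR_ge0 // -powRrM.
by rewrite (_ : 1 / 5 * 5 = 1) ?powRr1 //; field.
Qed.

Lemma horizon0 : horizon 0 = 1. Proof. by rewrite /horizon powR1. Qed.

(** The constant is a rational number just below the fifth root of 2. *)
Lemma horizon_growth k : 287 / 250 * horizon k <= horizon k.+1.
Proof.
have h0 := horizon_gt0 k; have h1 := horizon_gt0 k.+1.
suff : (287 / 250 * horizon k) ^+ 5 <= horizon k.+1 ^+ 5.
  rewrite ler_pXn2r // nnegrE; last exact: ltW.
  by apply: mulr_ge0; [lra | exact: ltW].
rewrite exprMn !horizonX5.
apply: (@le_trans _ _ (2 * (cp k)%:R)).
  by rewrite ler_wpM2r //; lra.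
by rewrite -natrM ler_nat change_point_double.
Qed.

Lemma horizon_le k : horizon k <= horizon k.+1.
Proof. by have := horizon_growth k; have := horizon_gt0 k; lra. Qed.

Lemma horizon_mono i j : (i <= j)%N -> horizon i <= horizon j.
Proof.
by apply: (homo_leq (r := <=%R)) => // [? ? ?|k]; [exact: le_trans | exact: horizon_le].
Qed.

Lemma horizon_ge1 k : 1 <= horizon k.
Proof. by rewrite -horizon0; exact: horizon_mono. Qed.

Lemma horizonX4_growth k : 50 / 29 * horizon k ^+ 4 <= horizon k.+1 ^+ 4.
Proof.
apply: (@le_trans _ _ ((287 / 250 * horizon k) ^+ 4)).
  rewrite exprMn ler_wpM2r ?exprn_ge0 ?ltW ?horizon_gt0 //; lra.
have h0 := horizon_gt0 k; have h1 := horizon_gt0 k.+1.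
by rewrite lerXn2r ?horizon_growth // nnegrE; lra.
Qed.

(* The bounds are those of the geometric series of ratio 2 ^ (- 4 / 5) < 29 / 50. *)
Lemma sum_horizonX4 n : \sum_(k < n.+1) horizon k ^+ 4 <= 50 / 21 * horizon n ^+ 4.
Proof.
elim: n => [|n IH]; first by rewrite big_ord1 horizon0 expr1n; lra.
by rewrite big_ord_recr /=; have := horizonX4_growth n; lra.
Qed.

(** A geometric series of ratio [250 / 287], whose sum [287 / 37] is below 8. *)
Lemma sum_horizon n : \sum_(k < n.+1) horizon k <= 8 * horizon n.
Proof.
elim: n => [|n IH]; first by rewrite big_ord1 horizon0; lra.
by rewrite big_ord_recr /=; have := horizon_growth n; have := horizon_gt0 n; lra.
Qed.

Lemma sum_horizonXN4 n : \sum_(k < n.+1) horizon k ^- 4 <= 50 / 21.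
Proof.
(* Keeping the remainder of the geometric series makes the bound inductive. *)
suff : \sum_(k < n.+1) horizon k ^- 4 <= 50 / 21 - 29 / 21 * horizon n ^- 4.
  have h0 := ltW (horizon_gt0 n).
  have : 0 <= horizon n ^- 4 by rewrite invr_ge0 exprn_ge0.
  by move: (_ ^- 4) (\sum_(k < _) _) => x s; lra.
elim: n => [|n IH]; first by rewrite big_ord1 horizon0 expr1n invr1; lra.
rewrite big_ord_recr /=.
have x0 : 0 < horizon n ^+ 4 by rewrite exprn_gt0 ?horizon_gt0.
have y0 : 0 < horizon n.+1 ^+ 4 by rewrite exprn_gt0 ?horizon_gt0.
have : horizon n.+1 ^- 4 <= 29 / 50 * horizon n ^- 4.
  have := horizonX4_growth n; move: (_ ^+ 4) (_ ^+ 4) x0 y0 => x y x0 y0 H.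
  by rewrite ler_pdivlMr // mulrC ler_pdivrMr //; lra.
by lra.
Qed.

Lemma horizon_unbounded (B : R) : exists k, B <= horizon k.
Proof.
have [B0|B0] := leP B 0; first by exists 0%N; rewrite horizon0 (le_trans B0).
exists (Num.bound (B ^+ 5)).
set k := Num.bound _; have h0 := horizon_gt0 k.
rewrite -(@ler_pXn2r _ 5) // ?nnegrE ?(ltW h0) ?(ltW B0) // horizonX5.
apply: (le_trans (ltW (archi_boundP (exprn_ge0 5 (ltW B0))))).
by rewrite ler_nat ltnW // change_point_ge.
Qed.

Definition epoch_log (k : nat) : R := ln (2 * (cp k)%:R ^+ 2).

Definition epoch_beta (k : nat) : R :=
  4 * (cp k)%:R `^ (3 / 10) * Num.sqrt (epoch_log k).

Lemma beta_atE t : beta_at R t = epoch_beta (epoch t). Proof. by []. Qed.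

Lemma ln_ge_half (x : R) : 2 <= x -> 2^-1 <= ln x.
Proof.
move=> x2; have x0 : 0 < x by lra.
rewrite -ler_expR lnK ?posrE //; apply: le_trans x2.
have := expR_ge1Dx (- 2^-1 : R); rewrite expRN => H.
have e0 := expR_gt0 (2^-1 : R).
have : expR (2^-1) * (1 - 2^-1) <= expR (2^-1) * (expR (2^-1))^-1 :> R by rewrite ler_pM2l.
by rewrite mulfV ?lt0r_neq0 //; lra.
Qed.

Lemma ln_2sqr_ge (n : nat) : (0 < n)%N -> 2^-1 <= ln (2 * n%:R ^+ 2) :> R.
Proof.
move=> n0; apply: ln_ge_half; have : 1 <= n%:R ^+ 2 :> R by rewrite exprn_ege1 // ler1n.
by lra.
Qed.

Lemma ln_2sqr_le (m n : nat) : (0 < m)%N -> (m <= n)%N ->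
  ln (2 * m%:R ^+ 2) <= ln (2 * n%:R ^+ 2) :> R.
Proof.
move=> m0 mn; have n0 := leq_trans m0 mn.
rewrite ler_ln ?posrE ?mulr_gt0 ?exprn_gt0 ?ltr0n //.
by rewrite ler_pM2l // lerXn2r ?nnegrE ?ler_nat.
Qed.

Lemma epoch_beta_ge0 k : 0 <= epoch_beta k.
Proof. by rewrite /epoch_beta !mulr_ge0 ?powR_ge0 ?sqrtr_ge0. Qed.

Lemma epoch_beta_sqr k : epoch_beta k ^+ 2 = 16 * horizon k ^+ 3 * epoch_log k.
Proof.
rewrite /epoch_beta !exprMn sqr_sqrtr; last first.
  by have := ln_2sqr_ge (change_point_gt0 k); rewrite -/(epoch_log k); lra.
congr (_ * _ * _); first by lra.
rewrite -!powR_mulrn ?powR_ge0 // -!powRrM; congr (_ `^ _); lra.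
Qed.

End Schedule.

(** * The run of the agent, cut into epochs *)

Section AgentRun.
Context (R : realType) (A O S : finType) (a0 : A).
Context (rho : environment R A O) (S0 : S) (f : S -> A -> O -> S)
  (r : S -> A -> O -> R) (hr : forall s a o, 0 <= r s a o <= 1).
Context (lam : R) (lam01 : 0 <= lam <= 1).
Implicit Types (st : agent_state R A S) (h : history A O).

Local Arguments before_action : simpl never.
Local Arguments after_action : simpl never.

Local Notation phi := (phi S0 f).
Local Notation agent := (agent_policy a0 S0 f r).

(** The agent state is carried along instead of being recomputed from the history, so that bounds
    can be proved from an arbitrary state. *)
Fixpoint run_regret (n : nat) h st : R :=
  if n is n'.+1 then
    let st1 := before_action (size h).+1 st in
    \sum_a unif R (greedy_gt0 a0 (qtab st1 (cur st1))) a * \sum_o rho h a o *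
      (lam - r (phi h) a o +
       run_regret n' (rcons h (a, o)) (after_action a0 f r (size h).+1 st1 a o))
  else 0.

Lemma run_regretS n h st (st1 := before_action (size h).+1 st) :
  run_regret n.+1 h st =
  \sum_a unif R (greedy_gt0 a0 (qtab st1 (cur st1))) a * \sum_o rho h a o *
    (lam - r (phi h) a o +
     run_regret n (rcons h (a, o)) (after_action a0 f r (size h).+1 st1 a o)).
Proof. by []. Qed.

Lemma run_rcons t st h a o : run a0 f r t st (rcons h (a, o)) =
  after_action a0 f r (t + size h) (before_action (t + size h) (run a0 f r t st h)) a o.
Proof.
elim: h t st => [|[b p] h IH] t st /=; first by rewrite addn0.
by rewrite IH addSnnS.
Qed.

Lemma sum_regretS (pi : policy R A O) n h :
  \sum_(k < n.+1) (lam - exp_reward rho S0 f r pi k h) =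
  \sum_a pi h a * \sum_o rho h a o * (lam - r (phi h) a o +
    \sum_(k < n) (lam - exp_reward rho S0 f r pi k (rcons h (a, o)))).
Proof.
rewrite big_ord_recl /=.
have -> : \sum_(k < n) (lam - exp_reward rho S0 f r pi (bump 0 k) h) =
    \sum_a pi h a * \sum_o rho h a o *
      \sum_(k < n) (lam - exp_reward rho S0 f r pi k (rcons h (a, o))).
  under [RHS]eq_bigr => a _ do (under eq_bigr => o _ do rewrite mulr_sumr; rewrite exchange_big /= mulr_sumr).
  rewrite exchange_big /=; apply: eq_bigr => k _.
  under [RHS]eq_bigr => a _ do (under eq_bigr => o _ do rewrite mulrBr; rewrite sumrB fdist_mean_cst mulrBr).
  by rewrite sumrB fdist_mean_cst.
have -> : lam - \sum_a pi h a * mean_reward rho S0 f r h a =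
    \sum_a pi h a * \sum_o rho h a o * (lam - r (phi h) a o).
  under [RHS]eq_bigr => a _ do (under eq_bigr => o _ do rewrite mulrBr; rewrite sumrB fdist_mean_cst mulrBr).
  by rewrite sumrB fdist_mean_cst.
rewrite -big_split; apply: eq_bigr => a _ /=; rewrite -mulrDr; congr (_ * _).
by rewrite -big_split; apply: eq_bigr => o _ /=; rewrite -mulrDr.
Qed.

Lemma run_regretE n h : run_regret n h (run a0 f r 1 (init_state R A S0) h) =
  \sum_(k < n) (lam - exp_reward rho S0 f r agent k h).
Proof.
elim: n h => [|n IH] h; first by rewrite big_ord0.
rewrite sum_regretS.
apply: eq_bigr => a _; congr (_ * _); apply: eq_bigr => o _; congr (_ * (_ + _)).
by rewrite -IH run_rcons add1n.
Qed.

Lemma before_action_id t st : epoch t = epoch t.-1 -> before_action t st = st.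
Proof.
move=> tE; case: st => c q n; rewrite /before_action /tau_at /epoch_start tE /= subrr eqxx.
by congr AgentState; apply/funext => s; apply/funext => a; rewrite ?addr0 ?muln1.
Qed.

Local Notation epoch_rec k L h st K :=
  (regret_rec a0 rho S0 f r (horizon R k) (epoch_beta R k) lam L h st K).

(** The case [i = 0] places the preceding iteration in the same epoch, so every [before_action] is
    the identity. *)
Lemma run_regret_same_epoch k L m h st :
  (forall i, (i <= L)%N -> epoch (size h + i) = k) ->
  run_regret (L + m) h st = epoch_rec k L h st (run_regret m).
Proof.
elim: L h st => [|L IH] h st hk //.
have e1 : epoch (size h).+1 = k by rewrite -(hk 1%N) // addn1.
have e0 : epoch (size h) = k by rewrite -(hk 0%N) // addn0.
rewrite addSn run_regretS before_action_id ?e1 ?e0 //=; apply: eq_bigr => a _; congr (_ * _).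
apply: eq_bigr => o _; congr (_ * (_ + _)).
rewrite IH => [|i iL]; last by rewrite size_rcons addSnnS hk.
by rewrite /after_action tau_atE beta_atE e1.
Qed.

Lemma run_regret_epoch k L m h st :
  (forall i, (i < L)%N -> epoch (size h + i).+1 = k) -> (0 < L)%N ->
  run_regret (L + m) h st =
  epoch_rec k L h (before_action (size h).+1 st) (run_regret m).
Proof.
case: L => // L hk _ /=.
have e1 : epoch (size h).+1 = k by rewrite -(hk 0%N) // addn0.
apply: eq_bigr => a _; congr (_ * _).
apply: eq_bigr => o _; congr (_ * (_ + _)).
rewrite (@run_regret_same_epoch k) => [|i iL]; last by rewrite size_rcons addSn hk.
by rewrite /after_action tau_atE beta_atE e1.
Qed.

(** The range is that of the last iteration executed, before the shift of the next one. *)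
Definition reachable h st := cur st = phi h /\ q_in_range (horizon R (epoch (size h))) st.

Lemma before_action_range h st : reachable h st ->
  q_in_range (horizon R (epoch (size h).+1)) (before_action (size h).+1 st).
Proof.
move=> [_ st_rng] s a; rewrite /= !tau_atE /=.
have /andP[q0 q1] := st_rng s a.
have := horizon_mono R (leq_epoch (size h)); lra.
Qed.

Lemma reachable_step h st a o : reachable h st -> reachable (rcons h (a, o))
  (after_action a0 f r (size h).+1 (before_action (size h).+1 st) a o).
Proof.
move=> st_reach; have [st_cur _] := st_reach; split; first by rewrite phi_rcons /= st_cur.
rewrite size_rcons.
apply: (qstep_range a0 f hr (horizon_ge1 R _) (epoch_beta_ge0 R _)).
exact: before_action_range.
Qed.

Lemma run_regret_prefix i m (B : R) h st : reachable h st ->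
  (forall h' st', reachable h' st' -> size h' = (size h + i)%N -> run_regret m h' st' <= B) ->
  run_regret (i + m) h st <= i%:R + B.
Proof.
elim: i h st => [|i IH] h st st_reach hB; first by rewrite add0r hB // addn0.
rewrite /=; apply: unif_greedy_mean_le => a _; rewrite -[leRHS](fdist_mean_cst (rho h a)).
apply: fdist_mean_le => o; have /andP[r0 _] := hr (phi h) a o.
have /andP[_ l1] := lam01.
have := IH _ _ (reachable_step a o st_reach).
rewrite size_rcons addSnnS => /(_ hB).
by rewrite -natr1; lra.
Qed.

Lemma reachable_init : reachable [::] (init_state R A S0).
Proof. by split => // s a /=; rewrite epoch0 horizon0 ler01 lexx. Qed.

End AgentRun.

(** * Summation over the epochs *)

Lemma pred_add_sub (a b : nat) : (0 < a)%N -> (a < b)%N -> (a.-1 + (b - a) = b.-1)%N.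
Proof. by lia. Qed.

Lemma leq_pred_minn (a b c : nat) : (a < minn b c)%N -> (a <= (minn b c).-1 < b)%N.
Proof. by lia. Qed.

Lemma opt_transfer (R : realType) (t t' D Delta q q' x : R) :
  t * Delta <= t' * Delta -> q' <= q + 21 / 20 * (20 / 21 * t' - 20 / 21 * t) ->
  q - (t * Delta + D + 1) <= x -> q' - (t' * Delta + D + 1) <= x + (t' - t).
Proof. lra. Qed.

Lemma epoch_change_point k : epoch (change_point k) = k.
Proof. by apply: epoch_eq; rewrite leqnn ltn_change_point. Qed.

Lemma epoch_pred_change_point k : (0 < k)%N -> epoch (change_point k).-1 = k.-1.
Proof.
case: k => // k _; apply: epoch_eq; have := ltn_change_point k.
by move: (change_point k.+1) (change_point k) => x y /=; lia.
Qed.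

Section RegretBound.
Context (R : realType) (A O S : finType) (a0 : A).
Context (rho : environment R A O) (S0 : S) (f : S -> A -> O -> S)
  (r : S -> A -> O -> R) (hr : forall s a o, 0 <= r s a o <= 1).
Context (pi : policy R A O) (lam tp Delta : R) (T : nat).
Hypothesis T0 : (0 < T)%N.
Hypothesis tp0 : 0 <= tp.
Hypothesis avgP : forall h n, (1 <= n)%N ->
  `|avg_reward_from rho S0 f r pi h n - lam| <= tp / n%:R.
Hypothesis Delta0 : 0 <= Delta.
Hypothesis distortion_le : forall u, 1 <= u -> tp <= u ->
  distortion rho S0 f r u <= Delta.

Local Notation phi := (phi S0 f).
Local Notation cp := change_point.
Local Notation tau := (@horizon R).
Local Notation u := (fun k => 20 / 21 * tau k).
Local Notation run_regret := (run_regret a0 rho S0 f r lam).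
Implicit Types (st : agent_state R A S) (h : history A O).

Let lam01 : 0 <= lam <= 1. Proof. exact: (lam_bound hr tp0 avgP). Qed.

Definition card_SA : R := #|S|%:R * #|A|%:R.

Definition sqrt_term : R := Num.sqrt (card_SA * ln (2 * T%:R ^+ 2)).

Definition slack (k : nat) (D : R) : R := tau k * Delta + D + 1.

Let card_SA_ge1 : 1 <= card_SA.
Proof.
rewrite /card_SA -natrM ler1n muln_gt0; apply/andP; split.
  by apply/card_gt0P; exists S0.
by apply/card_gt0P; exists a0.
Qed.

Let log0 : 0 <= ln (2 * T%:R ^+ 2) :> R.
Proof. by have := ln_2sqr_ge R T0; lra. Qed.

Let X0 : 0 <= sqrt_term. Proof. exact: sqrtr_ge0. Qed.

(** The argument of the root is at least one half, by [ln_2sqr_ge]. *)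
Lemma sqrt_term_ge : 7 / 10 <= sqrt_term.
Proof.
have SA0 : 0 <= card_SA by have := card_SA_ge1; lra.
suff : (7 / 10) ^+ 2 <= sqrt_term ^+ 2 by rewrite ler_pXn2r // nnegrE; lra.
rewrite sqr_sqrtr; last exact: mulr_ge0.
have := ln_2sqr_ge R T0; have := card_SA_ge1; move: (card_SA) (ln _) => x y; nra.
Qed.

(** The [3 / 2] is the constant 1 of [slack] plus one half from the visit counts; [16 * sqrt_term]
    comes from the bonuses; the last term is the surcharge [b * tau k] times the failure
    probability. *)
Definition epoch_cost (kappa : R) (k : nat) (b : R) : R :=
  tau k ^+ 4 * (kappa + 3 / 2 + 16 * sqrt_term) + 4 * card_SA * tau k + b * tau k ^- 4.

Lemma epoch_cost_le k (L : nat) (kappa D B b : R) : (cp k <= T)%N -> (L <= cp k)%N ->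
  0 <= kappa -> 0 <= D -> 0 <= b ->
  L%:R * ((kappa + slack k D) / tau k) + pot_range A S (tau k) (epoch_beta R k) L
   + B + (L%:R + b * tau k) * (2 * L%:R * expR (- epoch_log R k)) <=
  B + L%:R * Delta + (epoch_cost kappa k b + D * tau k ^+ 4).
Proof.
move=> kT Lk ka0 D0 b0; have t1 := horizon_ge1 R k.
have cp0 := change_point_gt0 k.
have bE := epoch_beta_sqr R k; have be0 := epoch_beta_ge0 R k.
have l2 := ln_2sqr_ge R cp0; have lT := ln_2sqr_le R cp0 kT.
have t5 := horizonX5 R k.
have L0 : 0 <= L%:R :> R by [].
have Lt : L%:R <= tau k ^+ 5 by rewrite t5 ler_nat.
rewrite /slack /epoch_cost.
have eE : expR (- epoch_log R k) = (2 * tau k ^+ 10)^-1.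
  rewrite expRN lnK ?posrE ?mulr_gt0 ?exprn_gt0 ?ltr0n //.
  by rewrite -t5 -exprM.
rewrite eE /epoch_log in bE *.
set l := ln _ in bE l2 lT; move: (epoch_beta R k) l bE be0 l2 lT => be l bE be0 l2 lT.
move: (tau k) t1 t5 Lt bE => t t1 t5 Lt bE {eE}; have t0 : 0 < t by lra.
have SA1 := card_SA_ge1; have SA0 : 0 <= card_SA by lra.
have H1 : L%:R * ((kappa + (t * Delta + D + 1)) / t) <=
    L%:R * Delta + t ^+ 4 * (kappa + D + 1).
  have -> : L%:R * ((kappa + (t * Delta + D + 1)) / t) =
      L%:R * Delta + L%:R / t * (kappa + D + 1) by field; exact: lt0r_neq0.
  rewrite lerD2l ler_wpM2r //; first by lra.
  by rewrite ler_pdivrMr // -exprSr.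
have H2 : L%:R / (1 + 2 * t) <= t ^+ 4 / 2.
  rewrite ler_pdivrMr; last by lra.
  by apply: le_trans Lt _; have : 0 <= t ^+ 4 by [rewrite exprn_ge0 // ltW]; rewrite exprS; lra.
have H3 : be * Num.sqrt (#|{: S * A}|%:R * L%:R) <= 4 * t ^+ 4 * sqrt_term.
  have t4 : 0 <= t ^+ 4 by rewrite exprn_ge0 // ltW.
  suff : (be * Num.sqrt (#|{: S * A}|%:R * L%:R)) ^+ 2 <= (4 * t ^+ 4 * sqrt_term) ^+ 2.
    have z1 : 0 <= be * Num.sqrt (#|{: S * A}|%:R * L%:R) by rewrite mulr_ge0 ?sqrtr_ge0.
    have z2 : 0 <= 4 * t ^+ 4 * sqrt_term by exact: mulr_ge0 (mulr_ge0 (ler0n R 4) t4) X0.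
    by rewrite ler_pXn2r ?nnegrE.
  rewrite !exprMn bE !sqr_sqrtr ?mulr_ge0 //.
  rewrite card_prod natrM -/card_SA.
  apply: (@le_trans _ _ (16 * t ^+ 3 * ln (2 * T%:R ^+ 2) * (card_SA * t ^+ 5))).
    apply: ler_pM => //.
    - by rewrite !mulr_ge0 // ?exprn_ge0 ?(ltW t0) //; lra.
    - by rewrite mulr_ge0.
    - by rewrite ler_wpM2l // mulr_ge0 // exprn_ge0 // ltW.
    - by rewrite ler_wpM2l.
  by rewrite le_eqVlt; apply/orP; left; apply/eqP; ring.
(* As [expR (- epoch_log R k)] is the inverse of twice the squared change point, failure costs only
   a constant plus [b * t ^- 4]. *)
have H4 : (L%:R + b * t) * (2 * L%:R * (2 * t ^+ 10)^-1) <= 1 + b * t ^- 4.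
  have Lb : 0 <= L%:R + b * t by rewrite addr_ge0 // mulr_ge0 // ltW.
  apply: (@le_trans _ _ ((t ^+ 5 + b * t) * (2 * t ^+ 5 * (2 * t ^+ 10)^-1))).
    have i0 : 0 < (2 * t ^+ 10)^-1 by rewrite invr_gt0 mulr_gt0 // exprn_gt0.
    apply: ler_pM; [exact: Lb | | by rewrite lerD2r | by rewrite ler_pM2r // ler_pM2l].
    by apply: mulr_ge0; [exact: mulr_ge0 | exact: ltW].
  rewrite le_eqVlt; apply/orP; left; apply/eqP; field; exact: lt0r_neq0.
have H5 : t <= card_SA * t by rewrite ler_peMl // ltW.
have H6 : card_SA <= card_SA * t by rewrite ler_peMr.
rewrite /pot_range card_prod natrM -/card_SA in H3 *.
move: H1 H2 H3 H4; move: (_ / t) (_ / (1 + _)) (Num.sqrt _) (t ^- 4) ((2 * t ^+ 10)^-1) => x y z w v.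
lra.
Qed.

Let kappa : R := 21 / 20 * tp.

Let kappa0 : 0 <= kappa. Proof. exact: mulr_ge0. Qed.

Let bmax : R := 50 / 21 * tau (epoch T) ^+ 4.

Let bmax0 : 0 <= bmax.
Proof. by rewrite mulr_ge0 // exprn_ge0 // ltW ?horizon_gt0. Qed.

Let sumX4_le k : \sum_(k <= j < (epoch T).+1) tau j ^+ 4 <= bmax.
Proof.
have tj j : 0 <= tau j ^+ 4 by rewrite exprn_ge0 // ltW ?horizon_gt0.
have [kK|kK] := leqP k (epoch T).+1; last first.
  by rewrite big_geq //; exact: ltnW.
apply: le_trans (sum_horizonX4 R (epoch T)).
rewrite -(big_mkord xpredT (fun j => tau j ^+ 4)) [leRHS](@big_cat_nat _ _ _ k) //=.
by rewrite lerDr sumr_ge0.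
Qed.

(** Affine in [D]; the slope, a sum of later [tau j ^+ 4], is the price of each unit of lost
    optimism. *)
Definition regret_bound (k : nat) (D : R) : R :=
  (T.+1 - cp k)%:R * Delta +
  \sum_(k <= j < (epoch T).+1) (epoch_cost kappa j bmax + D * tau j ^+ 4).

Lemma epoch_cost_ge0 j : 0 <= epoch_cost kappa j bmax.
Proof.
have t0 := ltW (horizon_gt0 R j); have SA1 := card_SA_ge1.
have h1 : 0 <= tau j ^+ 4 * (kappa + 3 / 2 + 16 * sqrt_term).
  by apply: mulr_ge0; [exact: exprn_ge0 | have := kappa0; have := X0; lra].
have h2 : 0 <= 4 * card_SA * tau j by apply: mulr_ge0 => //; lra.
have h3 : 0 <= bmax * tau j ^- 4 by apply: mulr_ge0 => //; rewrite invr_ge0 exprn_ge0.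
by rewrite /epoch_cost addr_ge0 // addr_ge0.
Qed.

Lemma regret_bound_ge0 k D : 0 <= D -> 0 <= regret_bound k D.
Proof.
move=> D0; apply: addr_ge0; [exact: mulr_ge0 | apply: sumr_ge0 => j _].
by rewrite addr_ge0 ?epoch_cost_ge0 // mulr_ge0 // exprn_ge0 // ltW ?horizon_gt0.
Qed.

(** Optimism as it will hold once the table has been shifted at the start of epoch [k]. *)
Definition start_opt k D st := forall s a,
  qref rho S0 f r lam tp (u k) s a - slack k D <= qtab st s a + (tau k - tau k.-1).

(** Induction on the number of epochs left, for all [D], because a failure in epoch [k] passes
    [D + tau k] to the next one. *)
Lemma run_regret_le m k D h st : (k + m)%N = (epoch T).+1 -> (0 < k)%N ->
  4 <= tau k -> kappa <= tau k -> 0 <= D ->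
  reachable S0 f h st -> size h = (cp k).-1 -> start_opt k D st ->
  run_regret (T.+1 - cp k) h st <= regret_bound k D.
Proof.
elim: m k D h st => [|m IH] k D h st kK k0 t4 tk D0 st_reach hk st_opt.
  have -> : (T.+1 - cp k = 0)%N.
    by apply/eqP; rewrite subn_eq0; move: kK; rewrite addn0 => ->; exact: epoch_lt_change_point.
  exact: regret_bound_ge0.
have kT : (cp k <= T)%N.
  have /andP[eT _] := epochP T0; apply: leq_trans eT; apply: leq_change_point.
  by rewrite -ltnS -kK addnS ltnS leq_addr.
have cp0 := change_point_gt0 k.
(* Iteration [T] is the last one, so the epoch may be cut at [T.+1]. *)
pose L := (minn (cp k.+1) T.+1 - cp k)%N; pose m' := (T.+1 - cp k.+1)%N.
have kL : (cp k < minn (cp k.+1) T.+1)%N by rewrite leq_min ltn_change_point ltnS.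
have L0 : (0 < L)%N by rewrite subn_gt0.
have Lm : (T.+1 - cp k = L + m')%N.
  rewrite /L /m'; have [c|c] := leqP (cp k.+1) T.+1.
    by rewrite [RHS]addnC addnBA ?subnK // ltnW // ltn_change_point.
  by rewrite (_ : T.+1 - cp k.+1 = 0)%N ?addn0 //; apply/eqP; rewrite subn_eq0 ltnW.
have Lk : (L <= cp k)%N.
  rewrite leq_subLR addnn -mul2n geq_min.
  by case: (k) k0 => // k' _; rewrite change_pointS leqnn.
have ek i : (i < L)%N -> epoch (size h + i).+1 = k.
  move=> iL; apply: epoch_eq; rewrite hk -addSn prednK // leq_addr /=.
  by move: iL; rewrite ltn_subRL => /leq_trans; apply; exact: geq_minl.
have cpL : (size h + L = (minn (cp k.+1) T.+1).-1)%N.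
  by rewrite hk /L pred_add_sub.
pose b := \sum_(k.+1 <= j < (epoch T).+1) tau j ^+ 4.
have b0 : 0 <= b by apply: sumr_ge0 => j _; rewrite exprn_ge0 // ltW ?horizon_gt0.
have u1 : 1 <= u k by have := t4; lra.
have tu : tp <= u k by move: tk; rewrite /kappa; lra.
have uE : 21 / 20 * u k = tau k by field.
have /andP[v0 v1] := vlow_bound hr tp0 avgP u1.
pose K := run_regret m'.
pose B := regret_bound k.+1 D.
have next_reach h' st' : cur st' = phi h' -> q_in_range (tau k) st' ->
    size h' = (size h + L)%N -> reachable S0 f h' st'.
  move=> st'_cur st'_rng h'L; split => //; rewrite h'L cpL.
  have -> : epoch (minn (cp k.+1) T.+1).-1 = k; last by [].
  exact/epoch_eq/leq_pred_minn.
have next D' h' st' : 0 <= D' -> cur st' = phi h' -> q_in_range (tau k) st' ->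
    size h' = (size h + L)%N -> start_opt k.+1 D' st' -> K h' st' <= regret_bound k.+1 D'.
  move=> D'0 st'_cur st'_rng h'L st'_opt; rewrite /K /m'.
  have [c|c] := ltnP T.+1 (cp k.+1).
    by rewrite (_ : T.+1 - cp k.+1 = 0)%N ?regret_bound_ge0 //; apply/eqP; rewrite subn_eq0 ltnW.
  have tS := horizon_le R k.
  apply: IH => //.
  - by rewrite addSnnS.
  - exact: le_trans tS.
  - exact: le_trans tS.
  - exact: next_reach.
  - by rewrite h'L cpL (minn_idPl c).
have K_range h' st' : cur st' = phi h' -> q_in_range (tau k) st' ->
    size h' = (size h + L)%N -> K h' st' <= B + b * tau k.
  move=> st'_cur st'_rng h'L.
  (* The next reference is at most [tau k.+1], so nonnegative entries shifted by [tau k.+1 - tau k]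
     are optimistic again with slack [D + tau k]. *)
  have t0 := ltW (horizon_gt0 R k); have D'0 : 0 <= D + tau k by rewrite addr_ge0.
  have -> : B + b * tau k = regret_bound k.+1 (D + tau k).
    rewrite /B /regret_bound -addrA; congr (_ + _); rewrite mulrC mulr_sumr -big_split /=.
    by apply: eq_bigr => j _; ring.
  apply: next => // s a; have /andP[q0 _] := st'_rng s a.
  have tS := horizon_le R k.
  have u1' : 1 <= u k.+1 by have := t4; lra.
  have := qref_le a0 rho S0 f hr lam tp u1' s a; have := vlow_bound hr tp0 avgP u1'.
  have : 0 <= tau k.+1 * Delta by rewrite mulr_ge0 // ltW ?horizon_gt0.
  by rewrite /slack /=; lra.
have K_opt h' st' : cur st' = phi h' -> q_in_range (tau k) st' ->
    opt (slack k D) (qref rho S0 f r lam tp (u k)) st' ->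
    size h' = (size h + L)%N -> K h' st' <= B.
  move=> st'_cur st'_rng st'_opt h'L; apply: next => // s a.
  have := optP s a st'_opt; have tS := horizon_le R k.
  have uS : u k <= u k.+1 by lra.
  have := qref_incr a0 hr tp0 avgP s a u1 uS.
  have : tau k * Delta <= tau k.+1 * Delta by rewrite ler_wpM2r.
  exact: opt_transfer.
rewrite Lm (run_regret_epoch _ _ _ _ _ _ _ _ ek L0).
have st1_rng := before_action_range st_reach.
rewrite -[X in epoch X.+1]addn0 ek // in st1_rng.
have sl1 : 1 <= slack k D.
  have : 0 <= tau k * Delta by rewrite mulr_ge0 // ltW ?horizon_gt0.
  by rewrite /slack; lra.
have slD : Delta <= slack k D / tau k.
  rewrite ler_pdivlMr ?horizon_gt0 // mulrC /slack; lra.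
have vb h' := vref_bound a0 hr tp0 avgP u1 h'.
have qB h' a : qref rho S0 f r lam tp (u k) (phi h') a - Delta <=
  \sum_o rho h' a o * (r (phi h') a o + (1 - (tau k)^-1) *
     vref a0 rho S0 f r lam tp (u k) (rcons h' (a, o))).
  have := qref_Bellman a0 hr tp0 avgP u1 h' a; rewrite uE; apply: le_trans.
  by rewrite lerB // distortion_le.
have low : lam * tau k - kappa <= 20^-1 * vlow lam tp (u k) + vlow lam tp (u k).
  have : lam * u k - tp <= vlow lam tp (u k) by rewrite le_max lexx.
  by rewrite /kappa; lra.
have H := @epoch_regret_le R A O S a0 rho S0 f r hr (tau k) (epoch_beta R k) (epoch_log R k)
  lam kappa (slack k D) Delta _ _ (qref rho S0 f r lam tp (u k)) _
  lam01 t4 (epoch_beta_ge0 R k) (epoch_beta_sqr R k) (ln_2sqr_ge R cp0) sl1 slD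
  (qref_le a0 rho S0 f hr lam tp u1) vb (vref_le_qref a0 rho S0 f hr lam tp u1) qB _ _ low kappa0
  L (size h + L)%N K B b b0 K_range K_opt h (before_action (size h).+1 st).
apply: le_trans (H _ _ _ _ _ _ _) _.
- by lra.
- by lra.
- by case: st_reach.
- exact: st1_rng.
- apply/forallP => -[s a] /=.
  by have := st_opt s a; rewrite !tau_atE hk prednK // epoch_change_point epoch_pred_change_point.
- move=> s a /=; rewrite /epoch_start hk prednK // epoch_change_point epoch_pred_change_point //.
  by case: (k) k0 => // k' _; rewrite gtn_eqF ?muln0 //; exact: ltn_change_point.
- by [].
apply: le_trans (epoch_cost_le B kT Lk kappa0 D0 b0) _.
rewrite /B /regret_bound [in leRHS]big_ltn; last first.
  by rewrite -kK addnS ltnS leq_addr.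
rewrite Lm natrD mulrDl -/m'.
have : epoch_cost kappa k b <= epoch_cost kappa k bmax.
  rewrite /epoch_cost lerD2l ler_wpM2r ?sumX4_le // invr_ge0 exprn_ge0 //.
  by rewrite ltW ?horizon_gt0.
by lra.
Qed.

End RegretBound.

Lemma pred_double (x : nat) : (0 < x)%N -> ((2 * x).-1 = x.-1 + x)%N.
Proof. by lia. Qed.

(** * The initial epochs and the total regret *)

Section FiniteAveragingTime.
Context (R : realType) (A O S : finType) (a0 : A).
Context (rho : environment R A O) (S0 : S) (f : S -> A -> O -> S)
  (r : S -> A -> O -> R) (hr : forall s a o, 0 <= r s a o <= 1).
Context (pi : policy R A O) (lam tp Delta : R) (T : nat).
Hypothesis T0 : (0 < T)%N.
Hypothesis tp0 : 0 <= tp.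
Hypothesis avgP : forall h n, (1 <= n)%N ->
  `|avg_reward_from rho S0 f r pi h n - lam| <= tp / n%:R.
Hypothesis Delta0 : 0 <= Delta.
Hypothesis distortion_le : forall u, 1 <= u -> tp <= u ->
  distortion rho S0 f r u <= Delta.

Local Notation cp := change_point.
Local Notation tau := (@horizon R).
Local Notation run_regret := (run_regret a0 rho S0 f r lam).

Let kappa : R := 21 / 20 * tp.
Let D0 : R := kappa + 4.

Let kappa0 : 0 <= kappa. Proof. exact: mulr_ge0. Qed.

Let lam01 : 0 <= lam <= 1. Proof. exact: (lam_bound hr tp0 avgP). Qed.

Definition good_epoch k := (4 <= tau k) && (kappa <= tau k).

Lemma bad_epoch_horizon k : ~~ good_epoch k -> tau k <= D0.
Proof.
rewrite negb_and -!ltNge /D0 => /orP[]; have := kappa0; lra.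
Qed.

(** Epoch 0 has 19 iterations. A later bad epoch [j] has [tau j ^+ 5] of them, at most
    [D0 * tau j ^+ 4]: the charge that good epochs also pay for [D0]. *)
Lemma bad_epoch_steps k : (forall j, (j < k)%N -> ~~ good_epoch j) ->
  (cp k).-1%:R <= 19 + D0 * \sum_(j < k) tau j ^+ 4.
Proof.
have D00 : 0 <= D0 by rewrite /D0; have := kappa0; lra.
have t4 j : 0 <= tau j ^+ 4 by rewrite exprn_ge0 // ltW ?horizon_gt0.
elim: k => [|[|k] IH] bad; first by rewrite big_ord0 /=; lra.
  by rewrite big_ord1 /= lerDl mulr_ge0.
have {}IH := IH (fun j jk => bad j (ltnW jk)).
have cpS : ((cp k.+2).-1 = (cp k.+1).-1 + cp k.+1)%N.
  by rewrite change_pointS pred_double ?change_point_gt0.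
rewrite big_ord_recr /= mulrDr addrA cpS natrD; apply: lerD; first exact: IH.
rewrite -horizonX5 exprS; apply: ler_wpM2r => //.
by apply: bad_epoch_horizon; exact: bad.
Qed.

Lemma exists_good_epoch : exists k, good_epoch k.
Proof.
have [k tk] := horizon_unbounded D0; exists k.
by rewrite /good_epoch; move: tk; rewrite /D0 => tk; apply/andP; split; have := kappa0; lra.
Qed.

Local Notation K := (epoch T).
Let bmax : R := 50 / 21 * tau K ^+ 4.
Local Notation X := (sqrt_term R A S T).

(** The coefficient of [tau j ^+ 4] contains [kappa] twice, from [epoch_cost] and from [D0]; times
    [50 / 21] this gives [5 * tp]. *)
Lemma sum_epoch_cost_le :
  \sum_(j < K.+1) (epoch_cost A S T kappa j bmax + D0 * tau j ^+ 4) <=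
  tau K ^+ 4 * (5 * tp + 275 / 21 + 800 / 21 * X + 2500 / 441)
  + 32 * card_SA R A S * tau K.
Proof.
have s4 := sum_horizonX4 R K; have s1 := sum_horizon R K; have sN := sum_horizonXN4 R K.
have X0 : 0 <= X by exact: sqrtr_ge0.
have SA0 : 0 <= card_SA R A S by rewrite mulr_ge0.
have t4 : 0 <= tau K ^+ 4 by rewrite exprn_ge0 // ltW ?horizon_gt0.
rewrite (eq_bigr (fun j : 'I_K.+1 => (kappa + 3 / 2 + 16 * X + D0) * tau j ^+ 4 +
   (4 * card_SA R A S * tau j + bmax * tau j ^- 4))); last first.
  by move=> j _; rewrite /epoch_cost; ring.
rewrite !big_split /= -!mulr_sumr.
have h1 := ler_wpM2l (_ : 0 <= kappa + 3 / 2 + 16 * X + D0) s4.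
have {}h1 := h1 ltac:(rewrite /D0; have := kappa0; lra).
have h2 := ler_wpM2l (_ : 0 <= 4 * card_SA R A S) s1.
have {}h2 := h2 ltac:(lra).
have h3 := ler_wpM2l (_ : 0 <= bmax) sN.
have {}h3 := h3 ltac:(rewrite /bmax; lra).
move: h1 h2 h3; rewrite /D0 /kappa /bmax.
move: (\sum_(k < _) _) (\sum_(k < _) _) (\sum_(k < _) _) => x y z.
lra.
Qed.

Lemma agent_regret_le :
  \sum_(k < T) (lam - exp_reward rho S0 f r (agent_policy a0 S0 f r) k [::]) <=
  19 + T%:R * Delta
  + tau K ^+ 4 * (5 * tp + 275 / 21 + 800 / 21 * X + 2500 / 441)
  + 32 * card_SA R A S * tau K.
Proof.
have D00 : 0 <= D0 by rewrite /D0; have := kappa0; lra.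
have t4 j : 0 <= tau j ^+ 4 by rewrite exprn_ge0 // ltW ?horizon_gt0.
have bmax0 : 0 <= bmax by rewrite /bmax mulr_ge0.
have cost0 j : 0 <= epoch_cost A S T kappa j bmax.
  exact: (epoch_cost_ge0 a0 S0 T tp0).
suff : \sum_(k < T) (lam - exp_reward rho S0 f r (agent_policy a0 S0 f r) k [::]) <=
    19 + T%:R * Delta + \sum_(j < K.+1) (epoch_cost A S T kappa j bmax + D0 * tau j ^+ 4).
  by have := sum_epoch_cost_le; lra.
rewrite -run_regretE /=.
have init : reachable S0 f [::] (init_state R A S0) by exact: reachable_init.
(* Before the first good epoch each step is charged 1; [run_regret_le] takes over from there. *)
have [k kgood kmin] := ex_minnP exists_good_epoch.
have bad j : (j < k)%N -> ~~ good_epoch j.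
  by move=> jk; apply/negP => /kmin; rewrite leqNgt jk.
have [Kk|kK] := ltnP K k.
  have step : run_regret (T + 0) [::] (init_state R A S0) <= T%:R + 0.
    by apply: (run_regret_prefix hr lam01 init) => h' st' _ _.
  rewrite addn0 addr0 in step; apply: (le_trans step).
  have : T%:R <= (cp K.+1).-1%:R :> R.
    by rewrite ler_nat -ltnS prednK ?change_point_gt0 // epoch_lt_change_point.
  have := @bad_epoch_steps K.+1 (fun j jK => bad j (leq_trans jK Kk)).
  rewrite big_split /= -mulr_sumr.
  have : 0 <= \sum_(j < K.+1) epoch_cost A S T kappa j bmax by apply: sumr_ge0.
  have : 0 <= T%:R * Delta by rewrite mulr_ge0.
  by lra.
have kT : (cp k <= T)%N.
  by have /andP[eT _] := epochP T0; apply: leq_trans eT; exact: leq_change_point.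
have cp0 := change_point_gt0 k.
have /andP[t4k tkk] := kgood.
have k0 : (0 < k)%N.
  by rewrite lt0n; apply/eqP => k0; move: t4k; rewrite k0 horizon0; lra.
have TE : (T = (cp k).-1 + (T.+1 - cp k))%N by rewrite pred_add_sub.
have bound h' st' : reachable S0 f h' st' -> size h' = (size ([::] : history A O) + (cp k).-1)%N ->
    run_regret (T.+1 - cp k) h' st' <= regret_bound A S tp Delta T k D0.
  move=> st'_reach h'k.
  apply: (run_regret_le a0 hr T0 tp0 avgP Delta0 distortion_le (m := K.+1 - k)) => //.
    by rewrite subnKC // ltnW // ltnS.
  (* Epoch [k.-1] is bad, so [tau k.-1 <= D0] and nonnegative entries suffice for optimism. *)
  move=> s a; have [_ st'_rng] := st'_reach; have /andP[q0 _] := st'_rng s a.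
  have u1 : 1 <= 20 / 21 * tau k by lra.
  have := qref_le a0 rho S0 f hr lam tp u1 s a; have := vlow_bound hr tp0 avgP u1.
  have : tau k.-1 <= D0 by apply/bad_epoch_horizon/bad; rewrite prednK.
  have : 0 <= tau k * Delta by rewrite mulr_ge0 // ltW ?horizon_gt0.
  by rewrite /slack; lra.
rewrite [X in run_regret X]TE.
apply: le_trans (run_regret_prefix hr lam01 init bound) _.
rewrite /regret_bound -/kappa -/bmax.
have := bad_epoch_steps bad.
have : (T.+1 - cp k)%:R * Delta <= T%:R * Delta by rewrite ler_wpM2r // ler_nat leq_subLR -add1n leq_add2r.
rewrite -(big_mkord xpredT (fun j => epoch_cost A S T kappa j bmax + D0 * tau j ^+ 4)).
rewrite -(big_mkord xpredT (fun j => tau j ^+ 4)).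
rewrite [X in _ -> _ -> _ <= _ + X](@big_cat_nat _ _ _ k) //=; last exact: leqW.
have : D0 * \sum_(0 <= j < k) tau j ^+ 4 <=
    \sum_(0 <= j < k) (epoch_cost A S T kappa j bmax + D0 * tau j ^+ 4).
  by rewrite mulr_sumr; apply: ler_sum => j _; rewrite lerDr.
by lra.
Qed.

End FiniteAveragingTime.

(** Here [x] is the last horizon and [y] is the fifth root of [T]. As [X] is at least [7 / 10],
    raising its coefficient from [800 / 21] to 120 absorbs 19, [275 / 21] and [2500 / 441]. *)
Lemma final_arithmetic (R : realType) (x y X tp SA n Delta c tp5 : R) :
  x <= y -> 1 <= x -> 7 / 10 <= X -> 0 <= SA -> 0 <= tp5 -> 0 <= n * Delta ->
  0 <= c * y -> 0 <= tp ->
  19 + n * Delta + x ^+ 4 * (5 * tp + 275 / 21 + 800 / 21 * X + 2500 / 441)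
    + 32 * SA * x <=
  (120 * X + 5 * tp) * y ^+ 4 + 3 * Delta * n + (54 * SA + 18 * c) * y + 2 * tp5.
Proof.
move=> xy x1 X07 SA0 tp50 nD cy tp0.
have x4 : x ^+ 4 <= y ^+ 4 by rewrite lerXn2r // nnegrE; lra.
have y1 : 1 <= y ^+ 4 by rewrite exprn_ege1 //; lra.
have h1 : x ^+ 4 * (5 * tp + 275 / 21 + 800 / 21 * X + 2500 / 441) <=
    y ^+ 4 * (5 * tp + 275 / 21 + 800 / 21 * X + 2500 / 441).
  by apply: ler_wpM2r x4; lra.
have h2 : SA * x <= SA * y by rewrite ler_wpM2l.
have h5 : 0 <= SA * y by apply: mulr_ge0 => //; lra.
have h3 : 0 <= (y ^+ 4 - 1) * 19 by rewrite mulr_ge0 //; lra.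
have h4 : 0 <= y ^+ 4 * (X - 7 / 10) by rewrite mulr_ge0 //; lra.
move: (x ^+ 4) (y ^+ 4) y1 h1 h3 h4 {x4} => a b b1 h1 h3 h4.
lra.
Qed.

Theorem theorem4 (R : realType) (A O S : finType) (a0 : A) (o0 : O)
    (rho : environment R A O) (S0 : S) (f : S -> A -> O -> S)
    (r : S -> A -> O -> R) (hr : forall s a o, 0 <= r s a o <= 1)
    (pi : policy R A O) (T : nat) (hT : (1 <= T)%N) :
  let tau := averaging_time rho S0 f r pi in
  ((regret rho S0 f r (agent_policy a0 S0 f r) pi T)%:E <=
    ((120 * Num.sqrt (#|S|%:R * #|A|%:R * ln (2 * T%:R ^+ 2)))%:E + 5%:E * tau)
      * (T%:R `^ (4 / 5))%:E
    + 3%:E * sup_distortion rho S0 f r tau * T%:R%:E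
    + ((54 * #|S|%:R * #|A|%:R + 18 * ln T%:R) * T%:R `^ (1 / 5))%:E
    + 2%:E * tau ^+ 5)%E.
Proof.
lazy zeta; set tau := averaging_time rho S0 f r pi; set lam := avg_reward rho S0 f r pi.
have tau_ge0 : (0 <= tau)%E.
  by apply: le_ereal_inf_tmp => _ [t [t0 _] <-]; rewrite lee_fin.
have T1 : 0 < T%:R :> R by rewrite ltr0n.
have y45 : 0 < T%:R `^ (4 / 5) :> R by exact: powR_gt0.
have y15 : 0 < T%:R `^ (1 / 5) :> R by exact: powR_gt0.
have sup_ge0 : (0 <= sup_distortion rho S0 f r tau)%E by rewrite le_max lexx.
have ln0 : 0 <= ln T%:R :> R by rewrite ln_ge0 // ler1n.
have log0 : 0 <= ln (2 * T%:R ^+ 2) :> R by have := ln_2sqr_ge R hT; lra.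
have sq0 : 0 <= 120 * Num.sqrt (#|S|%:R * #|A|%:R * ln (2 * T%:R ^+ 2)) :> R.
  by rewrite mulr_ge0 // sqrtr_ge0.
have c0 : 0 <= (54 * #|S|%:R * #|A|%:R + 18 * ln T%:R) * T%:R `^ (1 / 5) :> R.
  by rewrite mulr_ge0 ?(ltW y15) // addr_ge0 // mulr_ge0.
(* The infimum is attained: for fixed [h] and [n], the condition bounds every admissible averaging
   time from below by one number. *)
have avgP h n : tau \is a fin_num -> (1 <= n)%N ->
    `|avg_reward_from rho S0 f r pi h n - lam| <= fine tau / n%:R.
  move=> tau_fin n1; rewrite ler_pdivlMr ?ltr0n // -lee_fin fineK //.
  apply: le_ereal_inf_tmp => _ [t [_ tP] <-]; rewrite lee_fin.
  by rewrite -ler_pdivlMr ?ltr0n //; exact: tP.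
have distP u : 1 <= u -> (tau <= u%:E)%E ->
    ((distortion rho S0 f r u)%:E <= sup_distortion rho S0 f r tau)%E.
  move=> u1 tu; rewrite le_max; apply/orP; right.
  by apply: ereal_sup_ubound; exists u.
have ge0_neqNy (x : \bar R) : (0 <= x)%E -> x != -oo%E by case: x.
move: (sup_distortion rho S0 f r tau) sup_ge0 distP => G G0 distP.
have mul0 : (0 <= ((120 * Num.sqrt (#|S|%:R * #|A|%:R * ln (2 * T%:R ^+ 2)))%:E + 5%:E * tau)
    * (T%:R `^ (4 / 5))%:E)%E.
  by rewrite mule_ge0 ?adde_ge0 ?mule_ge0 // lee_fin // ltW.
have G1 : (0 <= 3%:E * G * T%:R%:E)%E by rewrite !mule_ge0.
have tau5 : (0 <= 2%:E * tau ^+ 5)%E by rewrite mule_ge0 // expe_ge0.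
(* If the averaging time or the distortion is infinite, the right-hand side is [+oo], because the
   powers of [T] that multiply them are positive. *)
have [tau_fin|] := boolP (tau \is a fin_num); last first.
  rewrite ge0_fin_numE // -leNgt leye_eq => /eqP tauE.
  suff -> : (((120 * Num.sqrt (#|S|%:R * #|A|%:R * ln (2 * T%:R ^+ 2)))%:E + 5%:E * tau)
      * (T%:R `^ (4 / 5))%:E)%E = +oo%E.
    by rewrite !addye ?leey // ?ge0_neqNy // tau5.
  by rewrite tauE gt0_muley ?lte_fin // addey // gt0_mulye ?lte_fin.
have [G_fin|] := boolP (G \is a fin_num); last first.
  rewrite ge0_fin_numE // -leNgt leye_eq => /eqP GE.
  suff -> : (3%:E * G * T%:R%:E)%E = +oo%E.
    by rewrite addey ?ge0_neqNy // !addye ?leey // ?ge0_neqNy.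
  by rewrite GE gt0_muley ?lte_fin // gt0_mulye ?lte_fin.
have {}avgP h n := avgP h n tau_fin.
move: tau_ge0 G0 {mul0 G1 tau5}; rewrite -(fineK tau_fin) -(fineK G_fin) !lee_fin.
rewrite -(fineK tau_fin) -(fineK G_fin) in distP.
move: (fine tau) (fine G) avgP distP => tp Delta avgP distP tp0 Delta0.
have distP' u : 1 <= u -> tp <= u -> distortion rho S0 f r u <= Delta.
  by move=> u1 tu; rewrite -lee_fin distP.
have := agent_regret_le a0 hr hT tp0 avgP Delta0 distP'.
rewrite regretE -/lam => H.
apply: (le_trans H); rewrite -[54 * _ * _]mulrA.
have -> : T%:R `^ (4 / 5) = (T%:R `^ (1 / 5)) ^+ 4 :> R.
  by rewrite -powR_mulrn ?powR_ge0 // -powRrM; congr (_ `^ _); field.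
have /andP[eT _] := epochP hT.
have hy : horizon R (epoch T) <= T%:R `^ (1 / 5).
  by rewrite ge0_ler_powR ?nnegrE // ler_nat.
have x1 := horizon_ge1 R (epoch T).
have X07 := sqrt_term_ge R a0 S0 hT.
have SA0 : 0 <= card_SA R A S by apply: mulr_ge0.
have tp5 : 0 <= tp * (tp * (tp * (tp * tp))) by do 4 apply: mulr_ge0 => //.
have TD : 0 <= T%:R * Delta by exact: mulr_ge0.
have lny : 0 <= ln (T%:R : R) * (T%:R : R) `^ (1 / 5) by apply: (mulr_ge0 ln0); exact: ltW.
exact: (final_arithmetic hy x1 X07 SA0 tp5 TD lny tp0).
Qed.
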